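(* Let $\Omega_0$ be a domain in $\mathbb{R}^{p+1}$ and $f_0\in C^{\omega}(\Omega_0,\mathbb{A})$ a real analytic function. Then the function $$CK[f_0](\mathbf{x})=\sum_{k=0}^{\infty}\frac{r^{2k}}{(2k)!}(-\Delta_{\mathbf{x}_p})^kf_0(\mathbf{x}_p)+\underline{\omega}\sum_{k=0}^{\infty}\frac{r^{2k+1}}{(2k+1)!}(-\Delta_{\mathbf{x}_p})^k\big(D_{\mathbf{x}_p}f_0(\mathbf{x}_p)\big),\qquad \mathbf{x}=\mathbf{x}_p+r\underline{\omega},$$ is a left generalized partial-slice Cauchy–Kovalevskaya extension of $f_0$ in a p-symmetric slice domain $\Omega\subseteq\Omega_0^{*}$ with $\Omega_0\subset\Omega$; that is, the series converge on $\Omega$, $CK[f_0]$ is left generalized partial-slice monogenic of type $(p,q)$ on $\Omega$, and $CK[f_0](\mathbf{x}_p)=f_0(\mathbf{x}_p)$ for $\mathbf{x}_p\in\Omega_0$.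
   Context: Let $\mathbb{A}$ be a real alternative algebra (the associator $[a,b,c]=(ab)c-a(bc)$ is an alternating trilinear function) with unity $1$, of finite real dimension $d>1$, equipped with an anti-involution $a\mapsto a^c$ (real linear, $a^c=a$ for $a\in\mathbb{R}$, $(a^c)^c=a$, $(ab)^c=b^ca^c$). Let $t(x)=x+x^c$, $n(x)=xx^c$, $\mathbb{S}_{\mathbb{A}}=\{x\in\mathbb{A}: t(x)=0,\ n(x)=1\}$ (assumed nonempty) and $Q_{\mathbb{A}}=\mathbb{R}\cup\{x: t(x)\in\mathbb{R},\ n(x)\in\mathbb{R},\ 4n(x)>t(x)^2\}$. Let $M$ be a real subspace with $\mathbb{R}\subsetneq M\subseteq Q_{\mathbb{A}}$ having a basis $(v_0,v_1,\dots,v_m)$, $m\ge1$, $v_0=1$, $v_s\in\mathbb{S}_{\mathbb{A}}$ and $v_sv_t=-v_tv_s$ for distinct $s,t\ge1$; complete it to a real basis of $\mathbb{A}$ and use the associated Euclidean norm. Identify $x=\sum_{s=0}^m x_sv_s\in M$ with $(x_0,\dots,x_m)\in\mathbb{R}^{m+1}$; $\mathbb{A}$-valued functions are differentiated componentwise, and $C^\omega$ means componentwise real analytic. Fix $p\in\{0,\dots,m-1\}$ and $q=m-p$; write $\mathbf{x}=\mathbf{x}_p+\underline{\mathbf{x}}_q$ with $\mathbf{x}_p=\sum_{s=0}^p x_sv_s$ (identified with $\mathbb{R}^{p+1}$) and $\underline{\mathbf{x}}_q=\sum_{s=p+1}^m x_sv_s$ (identified with $\mathbb{R}^q$). Let $\mathbb{S}=\{\sum_{s=p+1}^m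 x_sv_s:\sum x_s^2=1\}$; write $\underline{\mathbf{x}}_q=r\underline{\omega}$, $r=|\underline{\mathbf{x}}_q|\ge0$, $\underline{\omega}\in\mathbb{S}$. $D_{\mathbf{x}_p}f=\sum_{s=0}^p v_s\partial_{x_s}f$, $\Delta_{\mathbf{x}_p}=\sum_{s=0}^p\partial_{x_s}^2$. A function $f:\Omega\to\mathbb{A}$ ($\Omega\subseteq M$ open) is left generalized partial-slice monogenic of type $(p,q)$ if for every $\underline{\omega}\in\mathbb{S}$ its restriction to $\Omega_{\underline{\omega}}=\Omega\cap(\mathbb{R}^{p+1}\oplus\underline{\omega}\mathbb{R})$ is $C^1$ and $(D_{\mathbf{x}_p}+\underline{\omega}\partial_r)f(\mathbf{x}_p+r\underline{\omega})=0$ there. A domain $\Omega\subseteq M$ is a slice domain if $\Omega\cap\mathbb{R}^{p+1}\ne\emptyset$ and each $\Omega_{\underline{\omega}}$ is a domain in $\mathbb{R}^{p+2}$; it is p-symmetric if $\mathbf{x}_p+r\underline{\omega}\in\Omega$ with $r>0$ implies $\mathbf{x}_p+r\underline{\eta}\in\Omega$ for all $\underline{\eta}\in\mathbb{S}$. $\Omega_0^*=\{\mathbf{x}_p+\underline{\mathbf{x}}_q:\mathbf{x}_p\in\Omega_0,\ \underline{\mathbf{x}}_q\in\mathbb{R}^q\}$. *)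

(* Defs.v *)
From HB Require Import structures.
From mathcomp Require Import all_boot all_order all_algebra.
From mathcomp Require Import all_classical all_reals all_analysis.
Set Implicit Arguments. Unset Strict Implicit. Unset Printing Implicit Defensive.
Import Order.TTheory GRing.Theory Num.Theory.
Import numFieldNormedType.Exports.
Local Open Scope ring_scope.
Local Open Scope classical_set_scope.

Section Defs.
Variable R : realType.

Definition is_domain n (U : set 'rV[R]_n) : Prop := [/\ open U, connected U & U !=set0].

Definition C1_on n d (U : set 'rV[R]_n) (g : 'rV[R]_n -> 'rV[R]_d) : Prop :=
  forall i : 'I_n,
    [/\ (forall z, U z -> derivable g z (delta_mx 0 i)) &
        (forall z, U z -> {for z, continuous (fun y => derive g y (delta_mx 0 i))})].

Definition ranalytic_at n (g : 'rV[R]_n -> R) (a : 'rV[R]_n) : Prop :=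
  exists (c : {ffun 'I_n -> nat} -> R) (delta : R), [/\ 0 < delta &
    forall x : 'rV[R]_n, (forall i, `|x 0 i - a 0 i| < delta) ->
      let mon (al : {ffun 'I_n -> nat}) := c al * \prod_(i < n) (x 0 i - a 0 i) ^+ al i in
      let trunc N (al : {ffun 'I_n -> 'I_N}) := [ffun i => nat_of_ord (al i)] in
      [/\ (exists B : R, forall N, \sum_(al : {ffun 'I_n -> 'I_N}) `|mon (trunc N al)| <= B) &
      ((fun N => \sum_(al : {ffun 'I_n -> 'I_N}) mon (trunc N al)) @ \oo --> g x)]].

Definition ranalytic_on n d (U : set 'rV[R]_n) (f : 'rV[R]_n -> 'rV[R]_d) : Prop :=
  forall a, U a -> forall j : 'I_d, ranalytic_at (fun x => f x 0 j) a.

(* ---------- The algebra A = R^d (coordinates w.r.t. a fixed real basis) ---------- *)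
Section Algebra.
Variable d : nat.
Local Notation A := 'rV[R]_d.
Variables (mul : A -> A -> A) (one : A) (conj : A -> A).

Definition associator (a b c : A) : A := mul (mul a b) c - mul a (mul b c).

Definition is_real_elt (x : A) : Prop := exists c : R, x = c *: one.

Definition alt_algebra_with_anti_involution : Prop :=
  [/\ (1 < d)%N,
      [/\ (forall (k : R) (a b c : A), mul (k *: a + b) c = k *: mul a c + mul b c) &
          (forall (k : R) (a b c : A), mul a (k *: b + c) = k *: mul a b + mul a c)],
      [/\ (forall a, mul one a = a) & (forall a, mul a one = a)],
      (forall a b, [/\ associator a a b = 0, associator a b a = 0 & associator b a a = 0]) &
      [/\ (forall (k : R) (a b : A), conj (k *: a + b) = k *: conj a + conj b),
          (forall c : R, conj (c *: one) = c *: one),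
          (forall a, conj (conj a) = a) &
          (forall a b, conj (mul a b) = mul (conj b) (conj a))]].

Definition trA (x : A) : A := x + conj x.
Definition nA (x : A) : A := mul x (conj x).

Definition in_SA (x : A) : Prop := [/\ trA x = 0 & nA x = one].

Definition in_QA (x : A) : Prop :=
  is_real_elt x \/
  exists a b : R, [/\ trA x = a *: one, nA x = b *: one & a ^+ 2 < 4 * b].

(* ---------- the subspace M with basis v_0 = 1, v_1, ..., v_m, m = p + q ---------- *)
Variables (p q : nat).
Local Notation m1 := (p.+1 + q)%N.
Variable v : 'I_m1 -> A.

Definition idx0 : 'I_m1 := lshift q (@ord0 p).

(* x = sum_s x_s v_s, for x identified with (x_0,...,x_m) in R^{m+1} *)
Definition vecA (x : 'rV[R]_m1) : A := \sum_(s < m1) x 0 s *: v s.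

Definition M_hyp : Prop :=
  [/\ v idx0 = one,
      (forall s, s != idx0 -> in_SA (v s)),
      (forall s t, s != idx0 -> t != idx0 -> s != t -> mul (v s) (v t) = - mul (v t) (v s)),
      (forall x : 'rV[R]_m1, vecA x = 0 -> x = 0) &
      (forall x : 'rV[R]_m1, in_QA (vecA x))].

Definition vecq (w : 'rV[R]_q) : A := vecA (row_mx 0 w).

Definition eucl (u : 'rV[R]_q) : R := Num.sqrt (\sum_(i < q) u 0 i ^+ 2).
Definition in_sphere (w : 'rV[R]_q) : Prop := \sum_(i < q) w 0 i ^+ 2 = 1.

Definition pd n (f : 'rV[R]_n -> A) (i : 'I_n) : 'rV[R]_n -> A :=
  fun x => derive f x (delta_mx 0 i).

Definition Dxp (f : 'rV[R]_p.+1 -> A) : 'rV[R]_p.+1 -> A :=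
  fun y => \sum_(s < p.+1) mul (v (lshift q s)) (pd f s y).

Definition lapxp (f : 'rV[R]_p.+1 -> A) : 'rV[R]_p.+1 -> A :=
  fun y => \sum_(s < p.+1) pd (pd f s) s y.

Definition mlap_pow (k : nat) (f : 'rV[R]_p.+1 -> A) : 'rV[R]_p.+1 -> A :=
  iter k (fun g y => - lapxp g y) f.

Definition CK_term1 (f0 : 'rV[R]_p.+1 -> A) (y : 'rV[R]_p.+1) (r : R) (k : nat) : A :=
  (r ^+ (2 * k) / ((2 * k)`!)%:R) *: mlap_pow k f0 y.

Definition CK_term2 (f0 : 'rV[R]_p.+1 -> A) (y : 'rV[R]_p.+1) (r : R) (k : nat) : A :=
  (r ^+ (2 * k).+1 / (((2 * k).+1)`!)%:R) *: mlap_pow k (Dxp f0) y.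

(* x = x_p + r omega with x_p = lsubmx x, r = |x_q|, omega = x_q / r
   (when r = 0 the omega-term vanishes anyway) *)
Definition CK (f0 : 'rV[R]_p.+1 -> A) (x : 'rV[R]_m1) : A :=
  let y := lsubmx x in
  let r := eucl (rsubmx x) in
  let w := r^-1 *: rsubmx x in
  limn (series (CK_term1 f0 y r)) + mul (vecq w) (limn (series (CK_term2 f0 y r))).

Definition CK_series_converge (f0 : 'rV[R]_p.+1 -> A) (Om : set 'rV[R]_m1) : Prop :=
  forall x, Om x ->
    [/\ cvgn (series (CK_term1 f0 (lsubmx x) (eucl (rsubmx x)))) &
        cvgn (series (CK_term2 f0 (lsubmx x) (eucl (rsubmx x))))].

(* the point x_p + r omega of M, for (x_p, r) in R^{p+2} *)
Definition slice_pt (w : 'rV[R]_q) (z : 'rV[R]_(p.+1 + 1)) : 'rV[R]_m1 :=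
  row_mx (lsubmx z) (rsubmx z 0 0 *: w).

Definition slice_set (Om : set 'rV[R]_m1) (w : 'rV[R]_q) : set 'rV[R]_(p.+1 + 1) :=
  [set z | Om (slice_pt w z)].

Definition r_idx : 'I_(p.+1 + 1) := rshift p.+1 (@ord0 0).
Definition xp_idx (s : 'I_p.+1) : 'I_(p.+1 + 1) := lshift 1 s.

Definition gps_monogenic (f : 'rV[R]_m1 -> A) (Om : set 'rV[R]_m1) : Prop :=
  forall w : 'rV[R]_q, in_sphere w ->
    let g := fun z => f (slice_pt w z) in
    [/\ C1_on (slice_set Om w) g &
        forall z, slice_set Om w z ->
          \sum_(s < p.+1) mul (v (lshift q s)) (pd g (xp_idx s) z)
          + mul (vecq w) (pd g r_idx z) = 0].

Definition p_symmetric (Om : set 'rV[R]_m1) : Prop :=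
  forall (y : 'rV[R]_p.+1) (r : R) (w eta : 'rV[R]_q), 0 < r -> in_sphere w -> in_sphere eta ->
    Om (row_mx y (r *: w)) -> Om (row_mx y (r *: eta)).

Definition slice_domain (Om : set 'rV[R]_m1) : Prop :=
  [/\ (exists y : 'rV[R]_p.+1, Om (row_mx y 0)) &
      forall w : 'rV[R]_q, in_sphere w -> is_domain (slice_set Om w)].

End Algebra.
End Defs.

(* Main.v *)
Require Import Defs.
From HB Require Import structures.
From mathcomp Require Import all_boot all_order all_algebra.
From mathcomp Require Import all_classical all_reals all_analysis.
From mathcomp Require Import ring lra.
Import Order.TTheory GRing.Theory Num.Theory.
Import numFieldNormedType.Exports.
Local Open Scope ring_scope.
Local Open Scope classical_set_scope.

(** Write [omega D] for the operator [h |-> omega * (D h)].  Since [omega] anticommutes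
    with [v_1, ..., v_p], alternativity gives [(omega D)^2 = - Laplacian], so the extension
    restricted to the slice through [omega] is the single series
    [sum_k (r ^ k / k!) (omega D)^k f_0 (x_p)].  Formally it is [exp (r omega D) f_0], and
    applying [D + omega d/dr] makes it telescope because [omega * (omega * b) = - b].
    Convergence and termwise differentiation rest on local bounds
    [|d^I f_0| <= K |I|! K^|I|], which come from the power series: the polynomial box sums
    and all their derivatives are bounded uniformly, and this is enough to pass derivatives
    to the pointwise limit. *)

Set Implicit Arguments. Unset Strict Implicit. Unset Printing Implicit Defensive.

(** * Iterated partial derivatives *)

(** Each [omega D] consumes one derivative, so near [x_p] the [k]-th iterate on [f_0] has size at
    most [K (c K)^k k!], where [K] is the local analyticity constant and [c] the cost of one
    application. The factor [1 / k!] cancels the factorial and leaves a geometric series in [c K r].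
    Since [K] varies with [x_p], no uniform thickness is available: the domain is cut out by
    [4 c K r < 1] for some admissible [K]. The strict inequality makes it open; [c] can be taken
    independent of [omega], so only [r] enters and the domain is p-symmetric; shrinking [r]
    preserves the inequality, so every point of a slice is joined to [Omega_0]. The algebra is not
    associative, so products stay nested left multiplications [a (b x)] and are rearranged by the
    left alternative law and its polarization. Symmetry of mixed derivatives is carried as a
    property separate from their existence; it is proved for monomials and passed to the limit. *)

Section LinearFunctions.
Context {R : pzRingType} {V W : lmodType R} (l : V -> W) (ll : linear l).

Lemma lin0 : l 0 = 0.
Proof. by have := ll (-1) 0 0; rewrite scaler0 addr0 scaleN1r addNr. Qed.

Lemma linD a b : l (a + b) = l a + l b.
Proof. by rewrite -[a in LHS]scale1r ll scale1r. Qed.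

Lemma linZ k a : l (k *: a) = k *: l a.
Proof. by rewrite -[k *: a]addr0 ll lin0 addr0. Qed.

Lemma linN a : l (- a) = - l a.
Proof. by rewrite -scaleN1r linZ scaleN1r. Qed.

Lemma linB a b : l (a - b) = l a - l b.
Proof. by rewrite linD linN. Qed.

Lemma lin_sum (K : Type) (r : seq K) (P : pred K) (f : K -> V) :
  l (\sum_(k <- r | P k) f k) = \sum_(k <- r | P k) l (f k).
Proof. exact: (big_morph l linD lin0). Qed.

End LinearFunctions.

Section IteratedPartials.
Context {R : realType} {n : nat}.
Implicit Types (V W : normedModType R) (U : set 'rV[R]_n) (i j : 'I_n).
Implicit Types (I J : seq 'I_n).

Definition dpart V i (f : 'rV[R]_n -> V) : 'rV[R]_n -> V :=
  fun x => derive f x (delta_mx 0 i).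

Definition pdl V I (f : 'rV[R]_n -> V) : 'rV[R]_n -> V :=
  foldr (fun i g => dpart i g) f I.

Definition smooth V U (f : 'rV[R]_n -> V) : Prop :=
  forall I i z, U z -> derivable (pdl I f) z (delta_mx 0 i).

(** The tail [I] makes the property stable under [dpart], hence under [slice_D]; [slice_D_sq] uses
    it to cancel the cross terms. *)
Definition symm V U (f : 'rV[R]_n -> V) : Prop :=
  forall I i j z, U z -> pdl [:: i, j & I] f z = pdl [:: j, i & I] f z.

Lemma pdl_rcons V I i (f : 'rV[R]_n -> V) : pdl (rcons I i) f = pdl I (dpart i f).
Proof. by rewrite /pdl foldr_rcons. Qed.

Lemma open_eq_near V U (f g : 'rV[R]_n -> V) z : open U ->
  (forall y, U y -> f y = g y) -> U z -> \forall y \near z, f y = g y.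
Proof.
move=> oU fg Uz; have := open_nbhs_nbhs (conj oU Uz).
by apply: filterS => y; exact: fg.
Qed.

Lemma eq_dpart V U (f g : 'rV[R]_n -> V) i : open U ->
  (forall y, U y -> f y = g y) -> forall z, U z -> dpart i f z = dpart i g z.
Proof. by move=> oU fg z Uz; apply: near_eq_derive; exact: open_eq_near Uz. Qed.

Lemma eq_derivable V U (f g : 'rV[R]_n -> V) z v : open U ->
  (forall y, U y -> f y = g y) -> U z -> derivable f z v -> derivable g z v.
Proof. by move=> oU fg Uz; apply: near_eq_derivable; exact: open_eq_near Uz. Qed.

Lemma eq_pdl V U (f g : 'rV[R]_n -> V) I : open U ->
  (forall y, U y -> f y = g y) -> forall z, U z -> pdl I f z = pdl I g z.
Proof. by move=> oU fg; elim: I => //= i I IH; exact: eq_dpart. Qed.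

Lemma smooth_sub V U U' (f : 'rV[R]_n -> V) : U' `<=` U -> smooth U f -> smooth U' f.
Proof. by move=> UU sf I i z /UU; exact: sf. Qed.

Lemma smooth_dpart V U (f : 'rV[R]_n -> V) i : smooth U f -> smooth U (dpart i f).
Proof. by move=> sf I j z Uz; rewrite -pdl_rcons; exact: sf. Qed.

Lemma symm_dpart V U (f : 'rV[R]_n -> V) i : symm U f -> symm U (dpart i f).
Proof. by move=> sf I j k z Uz; rewrite -!pdl_rcons; exact: sf. Qed.

Lemma is_derive_linear V W (l : V -> W) (f : 'rV[R]_n -> V) x v df :
  linear l -> continuous l -> is_derive x v f df -> is_derive x v (l \o f) (l df).
Proof.
move=> ll cl [dfx dfe].
have H : (fun h => h^-1 *: (((l \o f) \o shift x) (h *: v) - (l \o f) x)) @ 0^' --> l df.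
  have -> : (fun h => h^-1 *: (((l \o f) \o shift x) (h *: v) - (l \o f) x)) =
    l \o (fun h => h^-1 *: ((f \o shift x) (h *: v) - f x)).
    by apply/funext => h /=; rewrite (linZ ll) (linB ll).
  apply: cvg_comp; last exact: cl.
  by move/cvg_ex: dfx => [d dfd]; rewrite -dfe /derive; move: (dfd) => /cvg_lim ->.
by split; [apply/cvg_ex; exists (l df) | apply/cvg_lim].
Qed.

Lemma pdl_linear V W U (l : V -> W) (f : 'rV[R]_n -> V) I :
  open U -> linear l -> continuous l -> smooth U f ->
  forall z, U z -> pdl I (l \o f) z = l (pdl I f z).
Proof.
move=> oU ll cl sf; elim: I => //= i I IH z Uz.
rewrite (eq_dpart i oU IH Uz).
by apply: (@derive_val _ _ _ _ _ _ _ (is_derive_linear ll cl (derivableP (sf I i z Uz)))).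
Qed.

Lemma smooth_linear V W U (l : V -> W) (f : 'rV[R]_n -> V) :
  open U -> linear l -> continuous l -> smooth U f -> smooth U (l \o f).
Proof.
move=> oU ll cl sf I i z Uz.
apply: (@eq_derivable _ U (l \o pdl I f)) => //.
  by move=> y Uy; rewrite (pdl_linear I oU ll cl sf).
exact: (@ex_derive _ _ _ _ _ _ _ (is_derive_linear ll cl (derivableP (sf I i z Uz)))).
Qed.

Lemma symm_linear V W U (l : V -> W) (f : 'rV[R]_n -> V) :
  open U -> linear l -> continuous l -> smooth U f -> symm U f -> symm U (l \o f).
Proof.
by move=> oU ll cl sf yf I i j z Uz; rewrite !(pdl_linear _ oU ll cl sf Uz) yf.
Qed.

Lemma pdl_cst0 V I : pdl I (cst (0 : V)) = cst 0.
Proof.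
by elim: I => //= i I ->; apply/funext => x; rewrite /dpart derive_cst.
Qed.

Lemma pdl_add V U (f g : 'rV[R]_n -> V) I : open U -> smooth U f -> smooth U g ->
  forall z, U z -> pdl I (f + g) z = pdl I f z + pdl I g z.
Proof.
move=> oU sf sg; elim: I => //= i I IH z Uz.
rewrite (eq_dpart i oU IH Uz); rewrite /dpart.
by rewrite -(deriveD (sf I i z Uz) (sg I i z Uz)).
Qed.

Lemma smooth_add V U (f g : 'rV[R]_n -> V) : open U -> smooth U f -> smooth U g ->
  smooth U (f + g).
Proof.
move=> oU sf sg I i z Uz.
apply: (@eq_derivable _ U (pdl I f + pdl I g) _ z _ oU _ Uz).
  by move=> y Uy; rewrite (pdl_add I oU sf sg).
by apply: derivableD; [exact: sf|exact: sg].
Qed.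

Lemma smooth_cst0 V U : smooth U (cst (0 : V)).
Proof. by move=> I i z _; rewrite pdl_cst0; exact: derivable_cst. Qed.

Lemma smooth_sum V U (K : Type) (r : seq K) (f : K -> 'rV[R]_n -> V) :
  open U -> (forall k, smooth U (f k)) -> smooth U (fun x => \sum_(k <- r) f k x).
Proof.
move=> oU sf; elim: r => [|k r IH].
  rewrite (_ : (fun x => _) = cst 0); first exact: smooth_cst0.
  by apply/funext => x; rewrite big_nil.
rewrite (_ : (fun x => _) = f k + (fun x => \sum_(k <- r) f k x)).
  exact: smooth_add.
by apply/funext => x; rewrite big_cons.
Qed.

Lemma pdl_sum V U (K : Type) (r : seq K) (f : K -> 'rV[R]_n -> V) I :
  open U -> (forall k, smooth U (f k)) -> forall z, U z ->
  pdl I (fun x => \sum_(k <- r) f k x) z = \sum_(k <- r) pdl I (f k) z.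
Proof.
move=> oU sf z Uz; elim: r => [|k r IH].
  rewrite big_nil (_ : (fun x => _) = cst 0) ?pdl_cst0 //.
  by apply/funext => x; rewrite big_nil.
rewrite big_cons -IH (_ : (fun x => _) = f k + (fun x => \sum_(k <- r) f k x)).
  by rewrite (pdl_add _ oU) //; exact: smooth_sum.
by apply/funext => x; rewrite big_cons.
Qed.

Lemma symm_sum V U (K : Type) (r : seq K) (f : K -> 'rV[R]_n -> V) :
  open U -> (forall k, smooth U (f k)) -> (forall k, symm U (f k)) ->
  symm U (fun x => \sum_(k <- r) f k x).
Proof.
move=> oU sf yf I i j z Uz.
have E J := pdl_sum r J oU sf Uz; rewrite (E [:: i, j & I]) (E [:: j, i & I]).
by apply: eq_bigr => k _; exact: yf.
Qed.

End IteratedPartials.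

(** * Linear maps and the coordinate norm in finite dimension *)

Section FiniteDimensional.
Context {R : realType}.

Lemma cvg_sum_seq (V : normedModType R) (T K : Type) (F : set_system T) {FF : Filter F}
    (r : seq K) (f : K -> T -> V) (a : K -> V) : (forall k, f k @ F --> a k) ->
  (fun x => \sum_(k <- r) f k x) @ F --> \sum_(k <- r) a k.
Proof.
move=> fa; elim: r => [|k r IH].
  by under eq_fun do rewrite big_nil; rewrite big_nil; exact: cvg_cst.
by under eq_fun do rewrite big_cons; rewrite big_cons; exact: cvgD.
Qed.

Lemma rV_coord_linear d (j : 'I_d) : linear (fun x : 'rV[R]_d => x 0 j : R).
Proof. by move=> k a b; rewrite !mxE. Qed.

Lemma scale_vec_linear (W : normedModType R) (w : W) : linear (fun k : R => k *: w).
Proof. by move=> k a b; rewrite scalerDl scalerA. Qed.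

Lemma scale_vec_continuous (W : normedModType R) (w : W) :
  continuous (fun k : R => k *: w).
Proof. by move=> k; apply: cvgZr_tmp; exact: cvg_id. Qed.

Lemma linear_rV_sum d (W : lmodType R) (l : 'rV[R]_d -> W) : linear l ->
  forall x, l x = \sum_(j < d) x 0 j *: l (delta_mx 0 j).
Proof.
move=> ll x; rewrite [in LHS](row_sum_delta x) (lin_sum ll).
by apply: eq_bigr => j _; rewrite (linZ ll).
Qed.

Lemma linear_rV_continuous d (W : normedModType R) (l : 'rV[R]_d -> W) :
  linear l -> continuous l.
Proof.
move=> ll; rewrite (_ : l = fun x => \sum_(j < d) x 0 j *: l (delta_mx 0 j)).
  move=> x; apply: (@cvg_sum_seq W _ _ (nbhs x) (nbhs_filter x)) => j; apply: cvgZr_tmp.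
  exact: coord_continuous.
by apply/funext => x; exact: linear_rV_sum.
Qed.

Lemma rV_norm_coord d (x : 'rV[R]_d) j : `|x 0 j| <= `|x|.
Proof.
rewrite [leRHS]/Num.Def.normr /= mx_normrE.
exact: (le_bigmax _ (fun ij : 'I_1 * 'I_d => `|x ij.1 ij.2|) (0, j)).
Qed.

Lemma rV_norm_le d (x : 'rV[R]_d) B : 0 <= B -> (forall j, `|x 0 j| <= B) -> `|x| <= B.
Proof.
move=> B0 xB; rewrite [leLHS]/Num.Def.normr /= mx_normrE.
by apply: bigmax_le => // -[i j] _ /=; rewrite ord1.
Qed.

Lemma linear_rV_bound d (W : normedModType R) (l : 'rV[R]_d -> W) : linear l ->
  forall x, `|l x| <= (\sum_(j < d) `|l (delta_mx 0 j)|) * `|x|.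
Proof.
move=> ll x; rewrite (linear_rV_sum ll) (le_trans (ler_norm_sum _ _ _)) //.
rewrite mulr_suml; apply: ler_sum => j _; rewrite normrZ mulrC.
by rewrite ler_wpM2l // rV_norm_coord.
Qed.

End FiniteDimensional.

(** * Limits of smooth functions *)

Section MeanValue.
Context {R : realType}.

(** The end points come in either order because the increments of a difference quotient take both
    signs. The bound on [|c - a|] replaces betweenness and is what a second mean value step
    needs. *)
Lemma mvt_interval (D : set R) (f df : R -> R) : is_interval D ->
  (forall t, D t -> is_derive t 1 f (df t)) ->
  forall a b, D a -> D b ->
  exists c, [/\ D c, `|c - a| <= `|b - a| & f b - f a = df c * (b - a)].
Proof.
move=> iD fD a b Da Db.
have H x y : x <= y -> D x -> D y ->
    exists c, [/\ D c, x <= c <= y & f y - f x = df c * (y - x)].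
  move=> xy Dx Dy.
  have inD z : z \in `[x, y]%R -> D z by rewrite in_itv /= => /(iD _ _ Dx Dy).
  have [|||c cxy E] := @MVT_segment R f df x y.
  - exact: xy.
  - by move=> z zxy; apply/fD/inD/subset_itv_oo_cc.
  - apply: derivable_within_continuous => z /inD Dz.
    exact: (@ex_derive _ _ _ _ _ _ _ (fD z Dz)).
  by exists c; split=> //; exact: inD.
have [ab|/ltW ba] := leP a b.
  have [c [Dc /andP[ac cb] E]] := H _ _ ab Da Db.
  by exists c; split=> //; rewrite !ger0_norm ?subr_ge0// lerD2r.
have [c [Dc /andP[bc ca] E]] := H _ _ ba Db Da.
exists c; split=> //; first by rewrite !ler0_norm ?subr_le0// !opprB lerD2l lerN2.
by rewrite -opprB E -mulrN opprB.
Qed.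

(** Two mean value steps: the remainder is [(df c - df a) (b - a)], and [df c - df a] is in turn a
    second derivative times [c - a]. The constant is [K] rather than the sharp [K / 2], which is
    harmless. *)
Lemma taylor1_bound (D : set R) (f df d2f : R -> R) K : is_interval D ->
  (forall t, D t -> is_derive t 1 f (df t)) ->
  (forall t, D t -> is_derive t 1 df (d2f t)) ->
  (forall t, D t -> `|d2f t| <= K) ->
  forall a b, D a -> D b -> `|f b - f a - df a * (b - a)| <= K * (b - a) ^+ 2.
Proof.
move=> iD fD dfD K2 a b Da Db.
have [c [Dc cab ->]] := mvt_interval iD fD Da Db.
have [e [De _]] := mvt_interval iD dfD Da Dc.
rewrite -mulrBl => ->; rewrite -mulrA normrM.
rewrite -(ger0_norm (sqr_ge0 (b - a))) ler_pM //; first exact: K2.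
by rewrite normrM normrX expr2 ler_wpM2r.
Qed.

Lemma is_derive_line (V W : normedModType R) (f : V -> W) x v t :
  derivable f (x + t *: v) v ->
  is_derive t 1 (fun s : R => f (x + s *: v)) (derive f (x + t *: v) v).
Proof.
have E : (fun h : R => h^-1 *: (((fun s : R => f (x + s *: v)) \o shift t) (h *: 1)
      - f (x + t *: v))) =
    (fun h : R => h^-1 *: ((f \o shift (x + t *: v)) (h *: v) - f (x + t *: v))).
  apply/funext => h /=; congr (_ *: (f _ - _)).
  by rewrite [h *: 1]mulr1 scalerDl addrCA.
move=> df; split; first by rewrite /derivable E.
by rewrite /derive E.
Qed.

Lemma is_derive_of_quadratic (V : normedModType R) (f : V -> R) x v l K :
  (\forall h \near (0 : R), `|f (x + h *: v) - f x - l * h| <= K * h ^+ 2) ->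
  is_derive x v f l.
Proof.
move=> fK.
have H : (fun h => h^-1 *: ((f \o shift x) (h *: v) - f x)) @ 0^' --> l.
  apply/cvgrPdist_le => e e0.
  (* [K] may be zero or negative, whereas [|K| + 1] can be divided by. *)
  have K1 : 0 < `|K| + 1 by rewrite ltr_pwDr.
  near=> h.
  have h0 : h != 0 by near: h; exact: nbhs_dnbhs_neq.
  have hK : `|f (x + h *: v) - f x - l * h| <= K * h ^+ 2.
    by near: h; rewrite near_withinE; apply: filterS fK.
  have he : `|h| <= e / (`|K| + 1).
    by near: h; apply: dnbhs0_le; rewrite divr_gt0.
  rewrite /= (_ : l - _ = - (h^-1 * (f (x + h *: v) - f x - l * h))); last first.
    rewrite [h *: v + x]addrC mulrBr [l * h]mulrC mulKf // opprB.
    by congr (_ - _).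
  rewrite normrN normrM normfV ler_pdivrMl ?normr_gt0 //.
  apply: (le_trans hK); rewrite -real_normK ?num_real // expr2 mulrCA ler_wpM2l //.
  rewrite (le_trans (ler_wpM2r (normr_ge0 h) (ler_norm K))) //.
  rewrite (le_trans _ (_ : (`|K| + 1) * `|h| <= _)) //.
    by rewrite ler_wpM2r // lerDl.
  by rewrite mulrC -ler_pdivlMr.
by split; [apply/cvg_ex; exists l|apply/cvg_lim].
Unshelve. all: by end_near. Qed.

End MeanValue.

Lemma cvg_norm_le {R : realType} (V : normedModType R) (u : nat -> V) l B :
  u @ \oo --> l -> (forall N, `|u N| <= B) -> `|l| <= B.
Proof.
move=> ul uB; have C : (fun N => `|u N|) @ \oo --> `|l| by apply: cvg_norm.
rewrite -(cvg_lim (@Rhausdorff R) C); apply: limr_le; first by apply/cvg_ex; eexists; exact: C.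
exact: nearW.
Qed.

Section LimitOfSmooth.
Context {R : realType} {n : nat}.
Implicit Types (a z : 'rV[R]_n) (I J : seq 'I_n).

(** Balls of row vectors are boxes for the sup norm, so each coordinate along a segment stays
    between two admissible values. Membership in a ball also records [0 < delta], which later proofs
    extract from it. *)
Lemma ball_line_interval a delta z (i : 'I_n) :
  is_interval [set t : R | ball a delta (z + t *: delta_mx 0 i)].
Proof.
move=> s u [d0 Hs] [_ Hu] t /andP[st tu]; split=> // k j.
move: (Hs k j) (Hu k j); rewrite ord1 /ball /= !mxE eqxx /=.
case: (j == i); rewrite /= ?mulr0 // !mulr1 !ltr_norml => /andP[? ?] /andP[? ?].
by lra.
Qed.

Lemma ball_line_near a delta z (i : 'I_n) : ball a delta z ->
  \forall h \near (0 : R), ball a delta (z + h *: delta_mx 0 i).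
Proof.
move=> bz; have oQ : nbhs z (ball a delta).
  by apply: open_nbhs_nbhs; split=> //; by apply: ball_open; case: bz.
have C : (fun h : R => z + h *: delta_mx 0 i) @ 0 --> z.
  rewrite -[X in _ --> X]addr0 -[X in _ + X](scale0r (delta_mx 0 i : 'rV[R]_n)).
  by apply: cvgD; [exact: cvg_cst|apply: cvgZr_tmp; exact: cvg_id].
exact: C.
Qed.

Lemma pdl_cat (V : normedModType R) I J (f : 'rV[R]_n -> V) :
  pdl I (pdl J f) = pdl (I ++ J) f.
Proof. by rewrite /pdl foldr_cat. Qed.

Lemma smooth_pdl (V : normedModType R) U I (f : 'rV[R]_n -> V) :
  smooth U f -> smooth U (pdl I f).
Proof. by move=> sf J i z Uz; rewrite pdl_cat; exact: sf. Qed.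

(* Pointwise convergence of values and of first derivatives suffices: a uniform bound on
   the second derivatives gives the Taylor remainder [K h^2], which survives the limit. *)
Lemma is_derive_limit a delta (phi : nat -> 'rV[R]_n -> R) (f : 'rV[R]_n -> R)
    (i : 'I_n) (K : R) :
  (forall N, smooth (ball a delta) (phi N)) ->
  (forall N z, ball a delta z -> `|pdl [:: i; i] (phi N) z| <= K) ->
  (forall z, ball a delta z -> phi ^~ z @ \oo --> f z) ->
  forall z l, ball a delta z -> (fun N => dpart i (phi N) z) @ \oo --> l ->
  is_derive z (delta_mx 0 i) f l.
Proof.
move=> sphi phiK phif z l bz phil.
apply: (@is_derive_of_quadratic _ _ _ _ _ _ K).
have := ball_line_near i bz; apply: filterS => h bh.
have b0 : ball a delta (z + 0 *: delta_mx 0 i) by rewrite scale0r addr0.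
set e := delta_mx 0 i in bh b0 *.
have T N : `|phi N (z + h *: e) - phi N z - dpart i (phi N) z * h| <= K * h ^+ 2.
  have := @taylor1_bound R [set t : R | ball a delta (z + t *: e)]
    (fun t => phi N (z + t *: e)) (fun t => dpart i (phi N) (z + t *: e))
    (fun t => pdl [:: i; i] (phi N) (z + t *: e)) K
    (@ball_line_interval a delta z i)
    (fun t bt => is_derive_line (sphi N [::] i _ bt))
    (fun t bt => is_derive_line (sphi N [:: i] i _ bt))
    (fun t bt => phiK N _ bt) 0 h b0 bh.
  by rewrite scale0r addr0 subr0.
apply: cvg_norm_le T; apply: cvgB; last by apply: cvgM => //; exact: cvg_cst.
by apply: cvgB; exact: phif.
Qed.

(** Induction on [I]: the next derivatives converge by assumption, and the bound two orders up lets
    [is_derive_limit] identify their limit as the derivative of [pdl I f]. *)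
Lemma pdl_limit a delta (phi : nat -> 'rV[R]_n -> R) (f : 'rV[R]_n -> R) :
  (forall N, smooth (ball a delta) (phi N)) ->
  (forall I, exists K, forall N z, ball a delta z -> `|pdl I (phi N) z| <= K) ->
  (forall I z, ball a delta z -> cvgn (fun N => pdl I (phi N) z)) ->
  (forall z, ball a delta z -> phi ^~ z @ \oo --> f z) ->
  smooth (ball a delta) f /\
  forall I z, ball a delta z -> (fun N => pdl I (phi N) z) @ \oo --> pdl I f z.
Proof.
move=> sphi phiK phic phif.
have step I i : (forall z, ball a delta z -> (fun N => pdl I (phi N) z) @ \oo --> pdl I f z) ->
    forall z, ball a delta z -> is_derive z (delta_mx 0 i) (pdl I f)
      (limn (fun N => pdl (i :: I) (phi N) z)).
  move=> cI z bz; have [K HK] := phiK [:: i, i & I].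
  apply: (@is_derive_limit a delta (fun N => pdl I (phi N)) _ i K _ _ cI z _ bz).
  - by move=> N; exact: smooth_pdl.
  - exact: HK.
  - exact: (phic (i :: I)).
have cv I z : ball a delta z -> (fun N => pdl I (phi N) z) @ \oo --> pdl I f z.
  elim: I z => [|i I IH] z bz; first exact: phif.
  have [_ E] := step I i IH z bz.
  rewrite [pdl (i :: I) f z]E; exact: (phic (i :: I)).
split=> // I i z bz.
exact: (@ex_derive _ _ _ _ _ _ _ (step I i (cv I) z bz)).
Qed.

(* Change the coordinates from those of [a] to those of [z] one at a time. *)
Lemma bounded_partials_lipschitz a delta (f : 'rV[R]_n -> R) K :
  (forall z i, ball a delta z -> derivable f z (delta_mx 0 i)) ->
  (forall z i, ball a delta z -> `|dpart i f z| <= K) ->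
  forall z, ball a delta z -> `|f z - f a| <= n%:R * K * `|z - a|.
Proof.
move=> df fK z bz; have d0 : 0 < delta by case: bz.
pose y k : 'rV[R]_n := \row_j (if (j < k)%N then z 0 j else a 0 j).
have by_ k : ball a delta (y k).
  split=> // i j; rewrite mxE ord1; case: ifP => _; last exact: ballxx.
  by have [_] := bz; exact.
have S k : (k <= n)%N -> `|f (y k) - f a| <= k%:R * K * `|z - a|.
  elim: k => [_|k IH kn].
    rewrite (_ : y 0%N = a); last by apply/rowP => j; rewrite mxE.
    by rewrite subrr normr0 !mul0r.
  rewrite -(subrKA (f (y k))) (le_trans (ler_normD _ _)) //.
  rewrite -[k.+1%:R]natr1 mulrDl mulrDl [leRHS]addrC mul1r lerD ?IH 1?ltnW //.
  pose i := Ordinal kn; pose h := z 0 i - a 0 i.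
  have E : y k.+1 = y k + h *: delta_mx 0 i.
    apply/rowP => j; rewrite !mxE ltnS leq_eqVlt eqxx /=.
    have -> : (j == i) = (j == k :> nat) by [].
    case: eqVneq => [jk|_] /=; last by rewrite mulr0 addr0.
    rewrite jk ltnn mulr1 /h (_ : j = i) ?subrKC //; exact: val_inj.
  have b0 : ball a delta (y k + 0 *: delta_mx 0 i) by rewrite scale0r addr0.
  have bh : ball a delta (y k + h *: delta_mx 0 i) by rewrite -E.
  have [c [Dc _]] := @mvt_interval R _ (fun t => f (y k + t *: delta_mx 0 i)) _
    (@ball_line_interval a delta (y k) i)
    (fun t bt => is_derive_line (df _ _ bt)) 0 h b0 bh.
  rewrite E scale0r addr0 subr0 => ->; rewrite normrM ler_pM //; first exact: fK.
  by have := rV_norm_coord (z - a) i; rewrite !mxE.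
have := S n (leqnn n); rewrite (_ : y n = z) //.
by apply/rowP => j; rewrite mxE ltn_ord.
Qed.

Lemma continuous_of_bounded_partials a delta (f : 'rV[R]_n -> R) K : 0 < delta ->
  (forall z i, ball a delta z -> derivable f z (delta_mx 0 i)) ->
  (forall z i, ball a delta z -> `|dpart i f z| <= K) ->
  {for a, continuous f}.
Proof.
move=> d0 df fK; apply/(@cvgrPdist_le _ _ _ _ (nbhs_filter a)) => e e0.
have K1 : 0 < n%:R * `|K| + 1 by rewrite ltr_pwDr // mulr_ge0.
apply/nbhs_ballP; exists (Num.min delta (e / (n%:R * `|K| + 1))) => /=.
  by rewrite lt_min d0 divr_gt0.
move=> z zm; have bz : ball a delta z.
  by apply: le_ball zm; rewrite ge_min lexx.
have ze : `|z - a| <= e / (n%:R * `|K| + 1).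
  by move: zm; rewrite -ball_normE /= lt_min distrC => /andP[_ /ltW].
rewrite distrC; apply: (le_trans (bounded_partials_lipschitz df fK bz)).
apply: (@le_trans _ _ ((n%:R * `|K| + 1) * `|z - a|)).
  by rewrite ler_wpM2r // ler_wpDr // ler_wpM2l // ler_norm.
by rewrite mulrC -ler_pdivlMr.
Qed.

Lemma cvg_rV d (T : Type) (F : set_system T) {FF : Filter F} (f : T -> 'rV[R]_d)
    (l : 'rV[R]_d) : (forall j, (fun t => f t 0 j) @ F --> l 0 j) -> f @ F --> l.
Proof.
move=> fl; rewrite [l]row_sum_delta.
rewrite (_ : f = fun t => \sum_(j < d) f t 0 j *: delta_mx 0 j); last first.
  by apply/funext => t; exact: row_sum_delta.
by apply: (@cvg_sum_seq _ _ _ _ F FF) => j; apply: cvgZr_tmp; exact: fl.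
Qed.

End LimitOfSmooth.

(** * Derivative bounds for real analytic functions *)

Section BoxSums.
Context {R : realType} {n : nat}.
Implicit Types F : {ffun 'I_n -> nat} -> R.

Definition nat_ffun N (al : {ffun 'I_n -> 'I_N}) : {ffun 'I_n -> nat} :=
  [ffun i => nat_of_ord (al i)].

Definition box_sum F (N : nat) : R := \sum_(al : {ffun 'I_n -> 'I_N}) F (nat_ffun al).

Lemma box_sum_nondecreasing F : (forall al, 0 <= F al) -> nondecreasing_seq (box_sum F).
Proof.
move=> F0; apply/nondecreasing_seqP => N.
pose w (al : {ffun 'I_n -> 'I_N}) : {ffun 'I_n -> 'I_N.+1} :=
  [ffun i => widen_ord (leqnSn N) (al i)].
have wi : injective w.
  move=> x y /ffunP xy; apply/ffunP => i; have := xy i; rewrite !ffunE => /(congr1 val) /=.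
  exact: val_inj.
rewrite /box_sum (bigID (mem (codom w)) xpredT) /=.
rewrite -[leLHS]addr0 lerD ?sumr_ge0 //.
rewrite (eq_bigl (fun al => al \in [set w x | x in [set: {ffun 'I_n -> 'I_N}]]%SET)).
  rewrite big_imset /=; last by move=> x y _ _; exact: wi.
  rewrite le_eqVlt; apply/orP; left; apply/eqP; rewrite big_mkcond [RHS]big_mkcond /=.
  apply: eq_bigr => al _; rewrite inE; congr F; apply/ffunP => i.
  by rewrite !ffunE.
move=> al; apply/codomP/imsetP => [[x ->]|[x _ ->]]; by [exists x|exists x].
Qed.

Lemma box_sumD F G N : box_sum (fun al => F al + G al) N = box_sum F N + box_sum G N.
Proof. exact: big_split. Qed.

(** Splits [F] as [(|F| + F) - |F|]: both parts are nonnegative, so their box sums increase, and the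
    bound [2 B] serves for both. *)
Lemma is_cvg_box_sum F B : (forall N, box_sum (fun al => `|F al|) N <= B) ->
  cvgn (box_sum F).
Proof.
move=> FB.
have C G : (forall al, 0 <= G al) -> (forall N, box_sum G N <= 2 * B) -> cvgn (box_sum G).
  move=> G0 GB; apply: nondecreasing_is_cvgn; first exact: box_sum_nondecreasing.
  by exists (2 * B) => _ [N _ <-].
have B0 : 0 <= B by apply: le_trans (FB 0%N); exact: sumr_ge0.
have -> : box_sum F = box_sum (fun al => `|F al| + F al) - box_sum (fun al => `|F al|).
  apply/funext => N; rewrite /= -[RHS]/(box_sum _ N - box_sum _ N).
  by rewrite box_sumD [RHS]addrC addKr.
apply: is_cvgB; apply: C => //.
- by move=> al; rewrite -lerBlDr sub0r ler_normr lexx orbT.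
- move=> N; rewrite mulr_natl mulr2n; apply: le_trans (lerD (FB N) (FB N)).
  by apply: (le_trans _ (_ : box_sum (fun al => `|F al| + `|F al|) N <= _));
     [apply: ler_sum => al _; rewrite lerD2l ler_norm|rewrite box_sumD].
- by move=> N; rewrite (le_trans (FB N)) // ler_peMl // ler1n.
Qed.

End BoxSums.

(** * Factorials and binomial coefficients *)

Section Counting.

Lemma leq_bin_exp2 m k : ('C(m, k) <= 2 ^ m)%N.
Proof.
elim: m k => [|m IH] [|k]; rewrite ?bin0 ?expn_gt0 //.
by rewrite binS expnS mul2n -addnn leq_add.
Qed.

Lemma leq_fact_mul a b : (a`! * b`! <= (a + b)`!)%N.
Proof.
rewrite -(bin_fact (leq_addr b a)) addKn.
by rewrite leq_pmull // bin_gt0 leq_addr.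
Qed.

Lemma leq_fact_add a b : ((a + b)`! <= 2 ^ (a + b) * (a`! * b`!))%N.
Proof.
rewrite -[X in (X <= _)%N](bin_fact (leq_addr b a)) addKn.
by rewrite leq_mul2r leq_bin_exp2 orbT.
Qed.

Lemma sum_count_mem (T : finType) (I : seq T) :
  (\sum_(i : T) count_mem i I = size I)%N.
Proof.
elim: I => [|j I IH] /=; first by rewrite big1.
rewrite big_split /= IH (bigD1 j) //= eqxx big1 // => i ij.
by rewrite eq_sym (negbTE ij).
Qed.

(** The quotient is a multinomial coefficient, hence at least 1. This merges the factorials of the
    separate coordinates into the single [(size I)!] of the derivative bounds. *)
Lemma leq_prod_fact (T : finType) (k : T -> nat) :
  (\prod_(i : T) (k i)`! <= (\sum_(i : T) k i)`!)%N.
Proof.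
apply: (big_ind2 (fun x y => (x <= y`!)%N)) => // x1 y1 x2 y2 h1 h2.
by apply: leq_trans (leq_fact_mul _ _); exact: leq_mul.
Qed.

End Counting.

(** * Derivatives of monomials *)

Section Monomials.
Context {R : realType} {n : nat}.
Implicit Types (a x : 'rV[R]_n) (I : seq 'I_n) (al : {ffun 'I_n -> nat}).

(** Moving along coordinate [j] changes one factor only; the product of the others is a constant [C]
    in the difference quotient. *)
Lemma is_derive_prod_coord (u : 'I_n -> R -> R) (j : 'I_n) (x : 'rV[R]_n) du :
  is_derive (x 0 j) 1 (u j) du ->
  is_derive x (delta_mx 0 j) (fun y : 'rV[R]_n => \prod_i u i (y 0 i))
    (du * \prod_(i | i != j) u i (x 0 i)).
Proof.
move=> [dj dje]; set C := \prod_(i | i != j) _.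
have H : (fun h => h^-1 *: (((fun y : 'rV[R]_n => \prod_i u i (y 0 i)) \o shift x)
     (h *: delta_mx 0 j) - \prod_i u i (x 0 i))) @ 0^' --> du * C.
  rewrite (_ : (fun h => _) =
    (fun h => (h^-1 *: ((u j \o shift (x 0 j)) (h *: 1) - u j (x 0 j))) * C)).
    apply: cvgM; last exact: cvg_cst.
    by move/cvg_ex: dj => [d dfd]; rewrite -dje /derive; move: (dfd) => /cvg_lim ->.
  apply/funext => h /=; rewrite (bigD1 j) //= [X in _ - X](bigD1 j) //= -/C.
  rewrite (_ : \prod_(i | i != j) _ = C); last first.
    by apply: eq_bigr => i ij; rewrite !mxE (negbTE ij) mulr0 add0r.
  by rewrite !mxE !eqxx -mulrBl -mulrA.
by split; [apply/cvg_ex; exists (du * C)|apply/cvg_lim].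
Qed.

(** The derivative along [I] of the monomial [(x - a) ^ al] in closed form. When a coordinate is
    differentiated more often than its exponent allows, the falling factorial vanishes, so the
    truncated subtraction does no harm. *)
Definition dmonomial a I al (x : 'rV[R]_n) : R :=
  \prod_(i < n) ((al i ^_ count_mem i I)%:R * (x 0 i - a 0 i) ^+ (al i - count_mem i I)).

Lemma is_derive_falling (b t : R) (m k : nat) :
  is_derive t 1 (fun s => (m ^_ k)%:R * (s - b) ^+ (m - k))
    ((m ^_ k.+1)%:R * (t - b) ^+ (m - k.+1)).
Proof.
have E : (m ^_ k.+1)%:R * (t - b) ^+ (m - k.+1) =
    (m ^_ k)%:R * ((m - k)%:R * (t - b) ^+ (m - k).-1) :> R.
  by rewrite ffactnSr natrM -mulrA subnS.
(* For [k >= m] the truncated exponent is 0: the function is constant, and the factor [m - k] makes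
   the claimed derivative 0. *)
rewrite E; case: (m - k)%N => [|l].
  rewrite mul0r mulr0 (_ : (fun s => _) = cst (m ^_ k)%:R); first exact: is_derive_cst.
  by apply/funext => s; rewrite expr0 mulr1.
have D : is_derive t (1 : R) (fun s : R => s - b) 1.
  by rewrite -[X in is_derive _ _ _ X]subr0; apply: is_deriveB.
have := is_deriveZ (V := R) (W := R) (m ^_ k)%:R (is_deriveX l.+1 D).
rewrite (_ : (m ^_ k)%:R \*: _ = fun s => (m ^_ k)%:R * (s - b) ^+ l.+1); last first.
  by apply/funext => s; rewrite /= exprfctE.
by move=> H; apply: is_derive_eq H _; rewrite /GRing.scale /= mulr1.
Qed.

Lemma is_derive_dmonomial a I al x (j : 'I_n) :
  is_derive x (delta_mx 0 j) (dmonomial a I al) (dmonomial a (j :: I) al x).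
Proof.
pose u (i : 'I_n) (t : R) :=
  (al i ^_ count_mem i I)%:R * (t - a 0 i) ^+ (al i - count_mem i I).
have := @is_derive_prod_coord u j x _ (is_derive_falling (a 0 j) (x 0 j) (al j) (count_mem j I)).
rewrite [X in is_derive _ _ _ X -> _](_ : _ = dmonomial a (j :: I) al x) //.
rewrite /dmonomial [RHS](bigD1 j) //= eqxx; congr (_ * _).
by apply: eq_bigr => i ij; rewrite eq_sym (negbTE ij).
Qed.

Lemma pdl_dmonomial a I al : pdl I (dmonomial a [::] al) = dmonomial a I al.
Proof.
elim: I => // i I IH; apply/funext => x.
rewrite [LHS]/= IH; exact: (@derive_val _ _ _ _ _ _ _ (is_derive_dmonomial a I al x i)).
Qed.

Lemma smooth_dmonomial U a al : smooth U (dmonomial a [::] al).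
Proof.
move=> I i z _; rewrite pdl_dmonomial.
exact: (@ex_derive _ _ _ _ _ _ _ (is_derive_dmonomial a I al z i)).
Qed.

Lemma symm_dmonomial U a al : symm U (dmonomial a [::] al).
Proof.
move=> I i j z _; rewrite !pdl_dmonomial /dmonomial.
by apply: eq_bigr => k _ /=; rewrite addnCA.
Qed.

(* A substitute for Cauchy's estimate: ['C(m, k) <= 2 ^ m]. *)
Lemma falling_bound (t h : R) m k : 0 < h -> `|t| <= h ->
  `|(m ^_ k)%:R * t ^+ (m - k)| <= (k`!)%:R * h^-1 ^+ k * (2 * h) ^+ m.
Proof.
move=> h0 th; have hn0 : h != 0 by rewrite gt_eqF.
have [km|mk] := leqP k m; last first.
  by rewrite ffact_small // mul0r normr0 !mulr_ge0 ?exprn_ge0 ?invr_ge0 ?mulr_ge0 // ltW.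
rewrite normrM normr_nat normrX -bin_ffact natrM.
apply: (@le_trans _ _ ((2 ^ m)%:R * k`!%:R * h ^+ (m - k))).
  apply: ler_pM => //.
    by rewrite ler_wpM2r // ler_nat leq_bin_exp2.
  by rewrite lerXn2r // nnegrE // ltW.
rewrite le_eqVlt; apply/orP; left; apply/eqP.
have E : (2 * h) ^+ m = 2 ^+ m * (h ^+ (m - k) * h ^+ k).
  by rewrite exprMn -exprD subnK.
by rewrite E natrX exprVn; field; rewrite expf_neq0.
Qed.

(** The last product is the value of the monomial at the corner [a + 2 h], so after multiplication
    by the coefficients the bounds add up to the absolute series at that corner. *)
Lemma dmonomial_bound a I al x h : 0 < h -> (forall i, `|x 0 i - a 0 i| <= h) ->
  `|dmonomial a I al x| <= ((size I)`!)%:R * h^-1 ^+ size I * \prod_(i < n) (2 * h) ^+ al i.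
Proof.
move=> h0 xh; rewrite /dmonomial normr_prod.
apply: (@le_trans _ _ (\prod_(i < n) ((count_mem i I)`!%:R * h^-1 ^+ count_mem i I *
   (2 * h) ^+ al i))).
  by apply: ler_prod => i _; rewrite normr_ge0 falling_bound.
rewrite !big_split /= ler_wpM2r ?prodr_ge0 // => [i _|].
  by rewrite exprn_ge0 // mulr_ge0 // ltW.
rewrite prodrXr sum_count_mem ler_wpM2r //; first by rewrite exprn_ge0 // invr_ge0 ltW.
by rewrite -natr_prod ler_nat -(sum_count_mem I) leq_prod_fact.
Qed.

End Monomials.

Section AnalyticBounds.
Context {R : realType} {n : nat}.

(* The offset [k] counts the derivatives that [f] already contains. *)
Definition factorial_bound (V : normedModType R) (U : set 'rV[R]_n) (f : 'rV[R]_n -> V)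
    (K B : R) (k : nat) : Prop :=
  forall I y, U y -> `|pdl I f y| <= B * ((size I + k)`!)%:R * K ^+ (size I + k).

(* The coefficients are controlled by the convergence at the corner [a + delta / 2] of the
   box; the estimates then hold on the box of half-width [delta / 4]. *)
Lemma ranalytic_at_local (f : 'rV[R]_n -> R) a : ranalytic_at f a ->
  exists K, [/\ 0 < K, smooth (ball a K^-1) f, symm (ball a K^-1) f &
    factorial_bound (ball a K^-1) f K K 0].
Proof.
move=> [c [delta [d0 H]]].
have h0 : 0 < delta / 4 by rewrite divr_gt0.
set h := delta / 4 in h0.
have x0a i : (a + const_mx (2 * h)) 0 i - a 0 i = 2 * h by rewrite !mxE; ring.
have h2 : `|2 * h| < delta by rewrite gtr0_norm ?mulr_gt0 // /h; lra.
have [|[B HB] _] := H (a + const_mx (2 * h)); first by move=> i; rewrite x0a.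
have B0 : 0 <= B by apply: le_trans (HB 0%N); exact: sumr_ge0.
pose phi N (x : 'rV[R]_n) := box_sum (fun al => c al * dmonomial a [::] al x) N.
have lc al : linear (fun t : R => c al * t).
  by move=> k x y; rewrite mulrDr /GRing.scale /= mulrCA.
have cc al : continuous (fun t : R => c al * t) by exact: mulrl_continuous.
have st al : smooth setT (fun x => c al * dmonomial a [::] al x).
  exact: (smooth_linear openT (lc al) (cc al) (@smooth_dmonomial R n setT a al)).
have sphi N : smooth setT (phi N).
  by apply: smooth_sum; [exact: openT|move=> al; exact: st].
have pphi I N y : pdl I (phi N) y = box_sum (fun al => c al * dmonomial a I al y) N.
  rewrite (pdl_sum _ I openT (fun al => st (nat_ffun al)) (z := y)) //.
  apply: eq_bigr => al _; rewrite -(pdl_dmonomial a I (nat_ffun al)).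
  exact: (pdl_linear I openT (lc (nat_ffun al)) (cc (nat_ffun al))
    (@smooth_dmonomial R n setT a (nat_ffun al)) (z := y) Logic.I).
have Qh y : ball a h y -> forall i, `|y 0 i - a 0 i| <= h.
  by move=> [_ by_] i; rewrite distrC ltW //; exact: by_.
have bnd I y N : ball a h y ->
    box_sum (fun al => `|c al * dmonomial a I al y|) N <=
    ((size I)`!)%:R * h^-1 ^+ size I * B.
  move=> /Qh yh; apply: le_trans (ler_wpM2l _ (HB N)); last first.
    by rewrite mulr_ge0 // exprn_ge0 // invr_ge0 ltW.
  rewrite mulr_sumr; apply: ler_sum => al _.
  rewrite !normrM mulrCA ler_wpM2l // [X in _ <= _ * X]normr_prod.
  apply: le_trans (dmonomial_bound I _ h0 yh) _.
  rewrite le_eqVlt; apply/orP; left; apply/eqP; congr (_ * _).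
  by apply: eq_bigr => i _; rewrite x0a normrX gtr0_norm ?mulr_gt0.
have cphi I y : ball a h y -> cvgn (fun N => pdl I (phi N) y).
  move=> yh; rewrite (_ : (fun N => _) = box_sum (fun al => c al * dmonomial a I al y)).
    by apply: is_cvg_box_sum => N; exact: bnd.
  by apply/funext => N; exact: pphi.
have Bphi I N y : ball a h y -> `|pdl I (phi N) y| <= ((size I)`!)%:R * h^-1 ^+ size I * B.
  by move=> yh; rewrite pphi (le_trans (ler_norm_sum _ _ _)) // bnd.
have phif y : ball a h y -> phi ^~ y @ \oo --> f y.
  move=> yh; have [|_] := H y.
    by move=> i; apply: le_lt_trans (Qh _ yh i) _; rewrite /h; lra.
  suff -> : phi ^~ y = (fun N => \sum_(al : {ffun 'I_n -> 'I_N})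
      c (nat_ffun al) * \prod_(i < n) (y 0 i - a 0 i) ^+ nat_ffun al i) by [].
  apply/funext => N; apply: eq_bigr => al _; congr (_ * _); apply: eq_bigr => i _.
  by rewrite ffactn0 mul1r subn0.
have [||||sf cf] := @pdl_limit R n a h phi f.
- by move=> N; exact: smooth_sub (sphi N).
- by move=> I; eexists => N y yh; exact: Bphi yh.
- exact: cphi.
- exact: phif.
(* One constant has three roles: amplitude, since [K >= B], and both growth rate and inverse radius,
   since [K >= h^-1]. *)
pose K := h^-1 + B + 1.
have hK : h^-1 <= K by rewrite /K -addrA lerDl addr_ge0.
have K0 : 0 < K by apply: lt_le_trans hK; rewrite invr_gt0.
have QK : ball a K^-1 `<=` ball a h.
  by move=> y; apply: le_ball; rewrite -[h]invrK lef_pV2 // posrE invr_gt0.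
exists K; split.
- exact: K0.
- exact: smooth_sub sf.
- move=> I i j y /QK yh; have c1 := cf [:: i, j & I] y yh; have c2 := cf [:: j, i & I] y yh.
  have E : (fun N => pdl [:: j, i & I] (phi N) y) = (fun N => pdl [:: i, j & I] (phi N) y).
    apply/funext => N; rewrite !pphi; apply: eq_bigr => al _; congr (_ * _).
    have := @symm_dmonomial R n setT a (nat_ffun al) I j i y Logic.I.
    by rewrite !pdl_dmonomial.
  by rewrite E in c2; exact: (cvg_unique _ c1 c2).
- move=> I y /QK yh; rewrite addn0.
apply: (cvg_norm_le (cf I y yh)) => N; apply: (le_trans (Bphi I N y yh)).
  rewrite (_ : _ * _ * B = B * ((size I)`!)%:R * h^-1 ^+ size I); last by ring.
  apply: ler_pM; [by rewrite mulr_ge0|by rewrite exprn_ge0 // invr_ge0 ltW| |].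
    by rewrite ler_wpM2r // /K addrAC lerDr // addr_ge0 // invr_ge0 ltW.
  by rewrite lerXn2r // nnegrE ?invr_ge0 ltW.
Qed.

End AnalyticBounds.

(** * Series of vector-valued functions *)

Section VectorValued.
Context {R : realType} {n d : nat}.
Implicit Types (U : set 'rV[R]_n) (f : 'rV[R]_n -> 'rV[R]_d).

Lemma rV_sum_coord f :
  f = (fun x => \sum_(j < d) ((fun t : R => t *: (delta_mx 0 j : 'rV[R]_d)) \o
    (fun x => f x 0 j)) x).
Proof. by apply/funext => x; exact: row_sum_delta. Qed.

Lemma smooth_rV U f : open U -> (forall j, smooth U (fun x => f x 0 j)) -> smooth U f.
Proof.
move=> oU sf; rewrite (rV_sum_coord f).
apply: (@smooth_sum R n _ U 'I_d (index_enum _)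
  (fun j => (fun t : R => t *: (delta_mx 0 j : 'rV[R]_d)) \o (fun x => f x 0 j)) oU) => j.
exact: (@smooth_linear R n R _ U (fun t : R => t *: (delta_mx 0 j : 'rV[R]_d)) (fun x => f x 0 j)
    oU (@scale_vec_linear R _ _) (@scale_vec_continuous R _ _) (sf j)).
Qed.

Lemma symm_rV U f : open U -> (forall j, smooth U (fun x => f x 0 j)) ->
  (forall j, symm U (fun x => f x 0 j)) -> symm U f.
Proof.
move=> oU sf yf; rewrite (rV_sum_coord f); apply: (symm_sum _ oU) => j.
  exact: (@smooth_linear R n R _ U (fun t : R => t *: (delta_mx 0 j : 'rV[R]_d)) (fun x => f x 0 j)
    oU (@scale_vec_linear R _ _) (@scale_vec_continuous R _ _) (sf j)).
exact: (@symm_linear R n R _ U (fun t : R => t *: (delta_mx 0 j : 'rV[R]_d)) (fun x => f x 0 j)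
    oU (@scale_vec_linear R _ _) (@scale_vec_continuous R _ _) (sf j) (yf j)).
Qed.

Lemma pdl_coord U f I (j : 'I_d) : open U -> smooth U f -> forall z, U z ->
  pdl I (fun x => f x 0 j) z = pdl I f z 0 j.
Proof.
move=> oU sf z Uz.
have lj := @rV_coord_linear R d j.
exact: (pdl_linear I oU lj (linear_rV_continuous lj) sf Uz).
Qed.

Lemma ranalytic_on_local U f : open U -> ranalytic_on U f -> forall a, U a ->
  exists K, [/\ 0 < K, ball a K^-1 `<=` U, smooth (ball a K^-1) f,
    symm (ball a K^-1) f & factorial_bound (ball a K^-1) f K K 0].
Proof.
move=> oU af a Ua.
have /nbhs_ballP [e /= e0 eU] : nbhs a U by exact: open_nbhs_nbhs.
have /choice [Kj HK] := fun j => ranalytic_at_local (af a Ua j).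
(* The term [e^-1] keeps the ball inside [U]; the sum dominates every [Kj], and all the bounds
   weaken as [K] grows. *)
pose K := e^-1 + \sum_(j < d) Kj j.
have S0 : 0 <= \sum_(j < d) Kj j by apply: sumr_ge0 => j _; case: (HK j) => /ltW.
have K0 : 0 < K by rewrite ltr_pwDl // invr_gt0.
have KjK j : Kj j <= K.
  rewrite /K (bigD1 j) //= addrCA lerDl addr_ge0 ?invr_ge0 ?(ltW e0) //.
  by apply: sumr_ge0 => i _; case: (HK i) => /ltW.
have Kj0 j : 0 < Kj j by case: (HK j).
have sub j : ball a K^-1 `<=` ball a (Kj j)^-1.
  by move=> y; apply: le_ball; rewrite lef_pV2 ?posrE.
have oB : open (ball a K^-1) by apply: ball_open; rewrite invr_gt0.
have sj j : smooth (ball a K^-1) (fun x => f x 0 j).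
  by have [_ s _ _] := HK j; exact: smooth_sub s.
have sf : smooth (ball a K^-1) f by exact: smooth_rV.
exists K; split.
- exact: K0.
- move=> y yB; apply: eU; apply: le_ball yB.
  by rewrite -[e]invrK lef_pV2 ?posrE ?invr_gt0 // /K lerDl.
- exact: sf.
- by apply: (symm_rV oB sj) => j; have [_ _ s _] := HK j => I i k z /(sub j); exact: s.
- move=> I y yB; apply: rV_norm_le.
    by rewrite !mulr_ge0 ?exprn_ge0 // ltW.
  move=> j; rewrite -(pdl_coord I j oB sf yB).
  have [_ _ _ b] := HK j; apply: le_trans (b I y (sub j y yB)) _.
  apply: ler_pM => //; [by rewrite mulr_ge0 // ltW|by rewrite exprn_ge0 // ltW| |].
    by rewrite ler_wpM2r.
  by rewrite lerXn2r // nnegrE ltW.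
Qed.

Lemma series_absolute_cvg (u : nat -> 'rV[R]_d) C :
  (forall N, \sum_(0 <= k < N) `|u k| <= C) -> cvgn (series u).
Proof.
move=> uC.
have cj j : cvgn (fun N => series u N 0 j).
  rewrite (_ : (fun N => _) = series (fun k => u k 0 j)); last first.
    by apply/funext => N; rewrite /series /= summxE.
  apply: normed_cvg; apply: nondecreasing_is_cvgn.
    by apply: nondecreasing_series => k _ _; exact: normr_ge0.
  exists C => _ [N _ <-]; apply: le_trans (uC N).
  by apply: ler_sum => k _; exact: rV_norm_coord.
apply/cvg_ex; exists (\row_j limn (fun N => series u N 0 j)).
by apply: cvg_rV => j; rewrite mxE; exact: cj.
Qed.

(** The summed norms make every differentiated series converge and bound the derivatives of the
    partial sums uniformly, so [pdl_limit] applies to each coordinate. Continuity is claimed at the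
    centre only, because each point can be taken as the centre of a ball of its own. A nonpositive
    radius gives an empty ball. *)
Lemma series_smooth a delta (T : nat -> 'rV[R]_n -> 'rV[R]_d) (Q := ball a delta)
    (S := fun z => limn (series (T ^~ z))) :
  (forall k, smooth Q (T k)) ->
  (forall I, exists C, forall N z, Q z -> \sum_(0 <= k < N) `|pdl I (T k) z| <= C) ->
  [/\ forall z, Q z -> cvgn (series (T ^~ z)), smooth Q S,
      forall I z, Q z -> series (fun k => pdl I (T k) z) @ \oo --> pdl I S z &
      0 < delta -> forall I, {for a, continuous (pdl I S)}].
Proof.
move=> sT bT.
have [d0|/negP nd0] := boolP (0 < delta); last first.
  have Q0 z : Q z -> False by case.
  by split=> //; [move=> z /Q0|move=> I i z /Q0|move=> I z /Q0].
have oQ : open Q by exact: ball_open.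
have cT I z : Q z -> cvgn (series (fun k => pdl I (T k) z)).
  by move=> Qz; have [C HC] := bT I; apply: (@series_absolute_cvg _ C) => N; exact: HC.
pose phi j N z := series (T ^~ z) N 0 j.
have sser N : smooth Q (fun z => series (T ^~ z) N) by exact: smooth_sum.
have lcj j := @rV_coord_linear R d j.
have ccj j := linear_rV_continuous (lcj j).
have sphi j N : smooth Q (phi j N).
  exact: (smooth_linear oQ (lcj j) (ccj j) (sser N)).
have pphi j I N z : Q z -> pdl I (phi j N) z = series (fun k => pdl I (T k) z) N 0 j.
  move=> Qz; rewrite (pdl_coord I j oQ (sser N) Qz).
  by rewrite (pdl_sum _ _ oQ sT Qz).
have bphi j I : exists K, forall N z, Q z -> `|pdl I (phi j N) z| <= K.
  have [C HC] := bT I; exists C => N z Qz; rewrite pphi //.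
  apply: le_trans (HC N z Qz); apply: le_trans (rV_norm_coord _ _) _.
  exact: ler_norm_sum.
have cvj j I z : Q z -> (fun N => pdl I (phi j N) z) @ \oo -->
    (limn (series (fun k => pdl I (T k) z))) 0 j.
  move=> Qz; rewrite (_ : (fun N => _) = (fun N => series (fun k => pdl I (T k) z) N 0 j)).
    by exact: (continuous_cvg _ (ccj j _) (cT I z Qz)).
  by apply/funext => N; exact: pphi.
have lim j := @pdl_limit R n a delta (phi j) (fun z => S z 0 j) (sphi j) (bphi j)
  (fun I z Qz => cvgP _ (cvj j I z Qz)) (fun z Qz => cvj j [::] z Qz).
have sS : smooth Q S by apply: smooth_rV => // j; case: (lim j).
split=> //.
- by move=> z Qz; exact: (cT [::]).
- move=> I z Qz; apply: cvg_rV => j.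
  have [_ /(_ I z Qz)] := lim j; rewrite (pdl_coord I j oQ sS Qz).
  suff -> : (fun N => pdl I (phi j N) z) = (fun N => series (fun k => pdl I (T k) z) N 0 j) by [].
  by apply/funext => N; exact: pphi.
move=> _ I.
apply: (@cvg_rV _ _ _ _ (nbhs_filter a)) => j.
have Qa : Q a by exact: ballxx.
(* Continuity of the derivative along [I] rests on bounds one order higher, uniform in [i]; the sum
   over [i] stands in for a maximum. *)
have [C HC] : exists C, forall i z, Q z -> `|pdl (i :: I) S z 0 j| <= C.
  have /choice [C HC] := fun i => bphi j (i :: I).
  exists (\sum_(i < n) `|C i|) => i z Qz; rewrite -(pdl_coord _ j oQ sS Qz).
  have [_ /(_ (i :: I) z Qz) L] := lim j.
  have := cvg_norm_le L (fun N => HC i N z Qz); move/le_trans; apply.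
  by rewrite (bigD1 i) //= ler_wpDr ?sumr_ge0 // ler_norm.
have sSj := lim j; case: sSj => sSj _.
have E z : Q z -> pdl I (fun x => S x 0 j) z = pdl I S z 0 j by exact: pdl_coord.
have : {for a, continuous (pdl I (fun x => S x 0 j))}.
  apply: (@continuous_of_bounded_partials R n a delta _ C d0) => z i Qz; first exact: sSj.
  by have := HC i z Qz; rewrite -(pdl_coord _ j oQ sS Qz).
move=> c; rewrite /continuous_at -(E a Qa); apply: cvg_trans c.
apply: near_eq_cvg.
exact: (open_eq_near oQ E Qa).
Qed.

End VectorValued.

(** * Divided powers of [r] times functions of [x_p] *)

Section PowerTimesFunction.
Context {R : realType}.

(* The [b]-th derivative of [s ^ k / k!]. *)
Definition divided_power (k b : nat) (s : R) : R :=
  if (b <= k)%N then s ^+ (k - b) / ((k - b)`!)%:R else 0.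

Lemma is_derive_divided_power k b (s : R) :
  is_derive s 1 (divided_power k b) (divided_power k b.+1 s).
Proof.
rewrite /divided_power; case: (leqP b k) => [bk|kb]; last first.
  by rewrite ltnNge (ltnW kb) /=; exact: is_derive_cst.
have E l : is_derive s (1 : R) (fun s : R => s ^+ l / (l`!)%:R) (l%:R * s ^+ l.-1 / (l`!)%:R).
  have := is_deriveZ (V := R) (W := R) (l`!)%:R^-1 (is_deriveX l (is_derive_id s (1 : R))).
  rewrite (_ : _ \*: _ = fun s => s ^+ l / (l`!)%:R); last first.
    by apply/funext => t; rewrite /= exprfctE /GRing.scale /= mulrC.
  by move=> H; apply: is_derive_eq H _; rewrite /GRing.scale /= mulr1 mulrC.
apply: is_derive_eq (E _) _.
case: ltnP => [bk'|kb]; last first.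
  by rewrite (_ : (k - b)%N = 0%N) ?mul0r //; apply/eqP; rewrite subn_eq0.
rewrite subnS; case: (k - b)%N (subn_gt0 b k) => [|l] /=; first by rewrite bk'.
move=> _; rewrite factS natrM; field.
by rewrite nat1r !pnatr_eq0 -!lt0n fact_gt0.
Qed.

Context {p d : nat}.
Local Notation z_ := 'rV[R]_(p.+1 + 1).

(** The terms [(r^k / k!) h_k(x_p)] have separated variables, so a derivative along [I] acts on the
    factors independently: along the sublist [y_part I] on one, [r_count I] times on the other. *)
Definition y_part (I : seq 'I_(p.+1 + 1)) : seq 'I_p.+1 :=
  pmap (fun i => if fintype.split i is inl s then Some s else None) I.

Definition r_count (I : seq 'I_(p.+1 + 1)) : nat :=
  count (fun i => if fintype.split i is inl _ then false else true) I.

Definition r_coord (z : z_) : R := rsubmx z 0 0.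

Lemma lsubmx_linear : linear (fun z : z_ => lsubmx z).
Proof. by move=> k x y; rewrite linearP. Qed.

Lemma r_coord_linear : linear r_coord.
Proof. by move=> k x y; rewrite /r_coord linearP !mxE. Qed.

Lemma lsubmx_delta_l (i : 'I_p.+1) : lsubmx (delta_mx 0 (lshift 1 i) : z_) = delta_mx 0 i.
Proof. by apply/rowP => j; rewrite !mxE eq_lshift. Qed.

Lemma lsubmx_delta_r (i : 'I_1) : lsubmx (delta_mx 0 (rshift p.+1 i) : z_) = 0.
Proof. by apply/rowP => j; rewrite !mxE eq_lrshift. Qed.

Lemma r_coord_delta_l (i : 'I_p.+1) : r_coord (delta_mx 0 (lshift 1 i) : z_) = 0.
Proof. by rewrite /r_coord !mxE eq_rlshift. Qed.

Lemma r_coord_delta_r (i : 'I_1) : r_coord (delta_mx 0 (rshift p.+1 i) : z_) = 1.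
Proof. by rewrite /r_coord !mxE eq_rshift ord1. Qed.

Lemma open_lsubmx (U : set 'rV[R]_p.+1) : open U -> open [set z : z_ | U (lsubmx z)].
Proof.
move=> oU; have := linear_rV_continuous lsubmx_linear.
by move=> /continuousP; apply.
Qed.

Lemma is_derive_product_l (c : R -> R) (G : 'rV[R]_p.+1 -> 'rV[R]_d) (z : z_) i :
  derivable G (lsubmx z) (delta_mx 0 i) ->
  is_derive z (delta_mx 0 (lshift 1 i)) (fun z => c (r_coord z) *: G (lsubmx z))
    (c (r_coord z) *: dpart i G (lsubmx z)).
Proof.
move=> /cvg_ex [l dG].
have H : (fun h => h^-1 *: (((fun z : z_ => c (r_coord z) *: G (lsubmx z)) \o shift z)
      (h *: delta_mx 0 (lshift 1 i)) - c (r_coord z) *: G (lsubmx z))) @ 0^' -->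
    c (r_coord z) *: dpart i G (lsubmx z).
  rewrite (_ : (fun h => _) = (fun h => c (r_coord z) *: (h^-1 *:
     ((G \o shift (lsubmx z)) (h *: delta_mx 0 i) - G (lsubmx z))))).
    apply: cvgZl_tmp; rewrite /dpart /derive; move: (dG) => /cvg_lim -> //.
  apply/funext => h /=; rewrite (linD r_coord_linear) (linZ r_coord_linear).
  rewrite (linD lsubmx_linear) (linZ lsubmx_linear) r_coord_delta_l lsubmx_delta_l.
  by rewrite scaler0 add0r -scalerBr scalerA mulrC -scalerA.
by split; [apply/cvg_ex; eexists; exact: H|apply/cvg_lim].
Qed.

Lemma is_derive_product_r (c : R -> R) dc (G : 'rV[R]_p.+1 -> 'rV[R]_d) (z : z_) i :
  is_derive (r_coord z) 1 c dc ->
  is_derive z (delta_mx 0 (rshift p.+1 i)) (fun z => c (r_coord z) *: G (lsubmx z))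
    (dc *: G (lsubmx z)).
Proof.
move=> [/cvg_ex [l dl] <-].
have H : (fun h => h^-1 *: (((fun z : z_ => c (r_coord z) *: G (lsubmx z)) \o shift z)
      (h *: delta_mx 0 (rshift p.+1 i)) - c (r_coord z) *: G (lsubmx z))) @ 0^' -->
    derive c (r_coord z) 1 *: G (lsubmx z).
  rewrite (_ : (fun h => _) = (fun h => (h^-1 *:
     ((c \o shift (r_coord z)) (h *: 1) - c (r_coord z))) *: G (lsubmx z))).
    apply: cvgZr_tmp; rewrite /derive; move: (dl) => /cvg_lim -> //.
  apply/funext => h /=; rewrite (linD r_coord_linear) (linZ r_coord_linear).
  rewrite (linD lsubmx_linear) (linZ lsubmx_linear) r_coord_delta_r lsubmx_delta_r.
  by rewrite scaler0 add0r -scalerBl scalerA.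
by split; [apply/cvg_ex; eexists; exact: H|apply/cvg_lim].
Qed.

Definition power_term (h : nat -> 'rV[R]_p.+1 -> 'rV[R]_d) (k : nat) (z : z_) : 'rV[R]_d :=
  divided_power k 0 (r_coord z) *: h k (lsubmx z).

Lemma is_derive_power_term U (h : nat -> 'rV[R]_p.+1 -> 'rV[R]_d) k I i z :
  smooth U (h k) -> U (lsubmx z) ->
  is_derive z (delta_mx 0 i)
    (fun z => divided_power k (r_count I) (r_coord z) *: pdl (y_part I) (h k) (lsubmx z))
    (divided_power k (r_count (i :: I)) (r_coord z) *: pdl (y_part (i :: I)) (h k) (lsubmx z)).
Proof.
move=> sh Uz; rewrite /r_count /y_part /=.
case: (splitP i) => [s is_|s is_].
  have -> : i = lshift 1 s by exact: val_inj.
  by apply: is_derive_product_l; exact: sh.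
have -> : i = rshift p.+1 s by exact: val_inj.
by apply: is_derive_product_r; exact: is_derive_divided_power.
Qed.

Lemma pdl_power_term U (h : nat -> 'rV[R]_p.+1 -> 'rV[R]_d) k I : open U ->
  smooth U (h k) -> forall z, U (lsubmx z) ->
  pdl I (power_term h k) z =
    divided_power k (r_count I) (r_coord z) *: pdl (y_part I) (h k) (lsubmx z).
Proof.
move=> oU sh; elim: I => // i I IH z Uz.
rewrite [LHS](eq_dpart i (open_lsubmx oU) IH Uz).
exact: (@derive_val _ _ _ _ _ _ _ (@is_derive_power_term U h k I i z sh Uz)).
Qed.

Lemma smooth_power_term U (h : nat -> 'rV[R]_p.+1 -> 'rV[R]_d) k : open U ->
  smooth U (h k) -> smooth [set z : z_ | U (lsubmx z)] (power_term h k).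
Proof.
move=> oU sh I i z Uz.
apply: (@eq_derivable _ _ _ [set z : z_ | U (lsubmx z)]
  (fun z => divided_power k (r_count I) (r_coord z) *: pdl (y_part I) (h k) (lsubmx z))).
- exact: open_lsubmx.
- by move=> y Uy; rewrite (pdl_power_term I oU sh Uy).
- exact: Uz.
exact: (@ex_derive _ _ _ _ _ _ _ (@is_derive_power_term U h k I i z sh Uz)).
Qed.

(* With [4 q |s| <= 1] the factor [2 ^ (m + k)] from [leq_fact_add] still leaves a geometric
   series of ratio [1 / 2]. *)
Lemma divided_power_bound k b m (s q : R) : 0 <= q -> 4 * q * `|s| <= 1 ->
  `|divided_power k b s| * ((m + k)`!%:R * q ^+ k) <=
  ((m + b)`!%:R * 2 ^+ m * (4 * q) ^+ b) * 2^-1 ^+ k.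
Proof.
move=> q0 qs; rewrite /divided_power; case: leqP => [bk|_]; last first.
  by rewrite normr0 mul0r !mulr_ge0 ?exprn_ge0 ?mulr_ge0 // invr_ge0.
rewrite -(subnK bk) addnK; set l := (k - b)%N.
rewrite normrM normfV normr_nat normrX.
have F : ((m + (l + b))`!)%:R <= 2 ^+ (m + (l + b)) * (((m + b)`!)%:R * (l`!)%:R) :> R.
  by rewrite -natrX -!natrM ler_nat [(l + b)%N]addnC addnA leq_fact_add.
apply: (@le_trans _ _ (`|s| ^+ l / (l`!)%:R *
   (2 ^+ (m + (l + b)) * (((m + b)`!)%:R * (l`!)%:R) * q ^+ (l + b)))).
  by apply: ler_wpM2l; rewrite ?mulr_ge0 ?exprn_ge0 // ler_wpM2r ?exprn_ge0.
have lf : (l`!)%:R != 0 :> R by rewrite pnatr_eq0 -lt0n fact_gt0.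
rewrite (_ : _ / _ * _ = (((m + b)`!)%:R * 2 ^+ m * (4 * q) ^+ b * 2^-1 ^+ (l + b)) *
   (4 * q * `|s|) ^+ l).
  by rewrite ler_piMr ?exprn_ile1 ?mulr_ge0 ?exprn_ge0 ?mulr_ge0.
rewrite (_ : 4 = 2 * 2 :> R); last by ring.
rewrite !exprD !exprMn !exprVn; field.
by rewrite lf !expf_neq0.
Qed.

Lemma sum_half_le N : \sum_(0 <= k < N) 2^-1 ^+ k <= 2 :> R.
Proof.
suff -> : \sum_(0 <= k < N) 2^-1 ^+ k = 2 - 2 * 2^-1 ^+ N :> R.
  by rewrite gerBl mulr_ge0 // exprn_ge0 // invr_ge0.
elim: N => [|N IH]; first by rewrite big_geq // expr0 mulr1 subrr.
by rewrite big_nat_recr //= IH exprS; field.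
Qed.

Lemma power_terms_summable (h : nat -> 'rV[R]_p.+1 -> 'rV[R]_d) (U : set 'rV[R]_p.+1)
    (K B c : R) I : open U -> 0 <= K -> 0 <= B -> 0 <= c ->
  (forall k, smooth U (h k)) -> (forall k, factorial_bound U (h k) K (B * c ^+ k) k) ->
  exists C, forall N (z : z_), U (lsubmx z) -> 4 * (c * K) * `|r_coord z| <= 1 ->
    \sum_(0 <= k < N) `|pdl I (power_term h k) z| <= C.
Proof.
move=> oU K0 B0 c0 sh bh; set m := size (y_part I); set b := r_count I.
set q := c * K; have q0 : 0 <= q by exact: mulr_ge0.
(* The product [B c^k (m + k)! K^(m + k)] is regrouped as [B K^m (m + k)! q^k];
   [divided_power_bound] then bounds the [k]-th norm by [C 2^-k], and the geometric sum gives the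
   final factor 2. *)
pose C := B * K ^+ m * ((m + b)`!%:R * 2 ^+ m * (4 * q) ^+ b).
have C0 : 0 <= C by rewrite !mulr_ge0 ?exprn_ge0 ?mulr_ge0.
exists (C * 2) => N z Uz zs.
apply: (@le_trans _ _ (\sum_(0 <= k < N) C * 2^-1 ^+ k)).
  apply: ler_sum => k _; rewrite (pdl_power_term I oU (sh k) Uz) normrZ.
  apply: le_trans (ler_wpM2l (normr_ge0 _) (bh k _ _ Uz)) _.
  rewrite -/m -/b exprD.
  rewrite (_ : _ * (B * _ * _ * _) = B * K ^+ m * (`|divided_power k b (r_coord z)| *
     ((m + k)`!%:R * q ^+ k))); last by rewrite /q exprMn; ring.
  rewrite /C -[X in _ <= X]mulrA ler_wpM2l ?mulr_ge0 ?exprn_ge0 //.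
  exact: divided_power_bound.
by rewrite -mulr_sumr ler_wpM2l // sum_half_le.
Qed.

End PowerTimesFunction.

(** * The operator omega D *)

Section AlternativeAlgebra.
Context {R : realType} {d : nat}.
Local Notation A := 'rV[R]_d.
Context (mul : A -> A -> A) (one : A) (conj : A -> A).
Context (Halg : alt_algebra_with_anti_involution mul one conj).
Context (p q : nat) (v : 'I_(p.+1 + q) -> A) (HM : M_hyp mul one conj v).

(** Adding the double sum to its transpose cancels everything off the diagonal and doubles the
    diagonal; 2 is invertible in a real vector space. No ordering of the index pairs is involved. *)
Lemma sum_antisymmetric (V : lmodType R) n (X : 'I_n -> 'I_n -> V) :
  (forall i j, i != j -> X i j = - X j i) ->
  \sum_i \sum_j X i j = \sum_i X i i.
Proof.
move=> aX; set S := \sum_i _.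
suff E : S + S = \sum_i X i i + \sum_i X i i.
  have H2 : (2 : R) != 0 by rewrite pnatr_eq0.
  by apply: (scalerI H2); rewrite !scaler_nat !mulr2n.
rewrite {2}/S exchange_big -!big_split /=; apply: eq_bigr => i _.
rewrite -big_split (bigD1 i) //= big1 ?addr0 // => j ji.
by rewrite (aX j i) // subrr.
Qed.

Lemma mul_linl b : linear (mul ^~ b).
Proof. by case: Halg => _ [H _] _ _ _ k x y; exact: H. Qed.

Lemma mul_linr a : linear (mul a).
Proof. by case: Halg => _ [_ H] _ _ _ k x y; exact: H. Qed.

Lemma mul1l a : mul one a = a.
Proof. by case: Halg => _ _ []. Qed.

Lemma left_alternative a b : mul a (mul a b) = mul (mul a a) b.
Proof.
by case: Halg => _ _ _ /(_ a b) [/eqP + _ _] _; rewrite subr_eq0 => /eqP.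
Qed.

(** Expand the left alternative law at [a + c] and remove the two pure terms. This stands in for
    associativity: left multiplications by anticommuting elements anticommute. *)
Lemma left_alternative_polarized a c b :
  mul a (mul c b) + mul c (mul a b) = mul (mul a c + mul c a) b.
Proof.
have := left_alternative (a + c) b.
rewrite !(linD (mul_linl _)) !(linD (mul_linr _)) !(linD (mul_linl _)).
rewrite -!left_alternative -!addrA => /addrI.
rewrite addrCA !addrA addrC => H.
by move: H; rewrite [RHS]addrC => /addrI <-; rewrite addrC.
Qed.

Lemma mul_anticomm a c b : mul a c = - mul c a -> mul a (mul c b) = - mul c (mul a b).
Proof.
move=> ac; apply/eqP; rewrite -addr_eq0 left_alternative_polarized ac addNr.
by rewrite (lin0 (mul_linl _)).
Qed.

(** Zero trace means [conj (v s) = - v s], so the norm condition becomes a statement about the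
    square. *)
Lemma mul_v_sq s : s != @idx0 p q -> mul (v s) (v s) = - one.
Proof.
case: HM => _ HS _ _ _ s0; have [t0 n1] := HS s s0.
have cv : conj (v s) = - v s by apply/eqP; rewrite -addr_eq0 addrC; apply/eqP.
by rewrite -n1 /nA cv (linN (mul_linr _)) opprK.
Qed.

Lemma mul_norm_bound : exists2 C : R, 0 <= C & forall a b, `|mul a b| <= C * `|a| * `|b|.
Proof.
exists (\sum_i \sum_j `|mul (delta_mx 0 i) (delta_mx 0 j)|).
  by apply: sumr_ge0 => i _; apply: sumr_ge0.
move=> a b; apply: le_trans (linear_rV_bound (mul_linl b) a) _.
rewrite mulrAC ler_wpM2r // mulr_suml; apply: ler_sum => i _.
exact: linear_rV_bound (mul_linr _) b.
Qed.

Lemma vecqE w : vecq v w = \sum_(i < q) w 0 i *: v (rshift p.+1 i).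
Proof.
rewrite /vecq /vecA big_split_ord /= big1 ?add0r => [|i _].
  by apply: eq_bigr => i _; rewrite row_mxEr.
by rewrite row_mxEl mxE scale0r.
Qed.

Lemma vecq_linear : linear (fun w : 'rV[R]_q => vecq v w).
Proof.
move=> k x y; rewrite !vecqE scaler_sumr -big_split; apply: eq_bigr => i _.
by rewrite !mxE scalerDl scalerA.
Qed.

Lemma in_sphere_le1 (w : 'rV[R]_q) i : in_sphere w -> `|w 0 i| <= 1.
Proof.
rewrite /in_sphere (bigD1 i) //= => w1.
rewrite -(@ler_pXn2r _ 2) ?nnegrE // expr1n real_normK ?num_real // -w1 lerDl.
by apply: sumr_ge0 => j _; exact: sqr_ge0.
Qed.

Lemma vecq_norm_le w : in_sphere w -> `|vecq v w| <= \sum_(i < q) `|v (rshift p.+1 i)|.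
Proof.
move=> ws; rewrite vecqE (le_trans (ler_norm_sum _ _ _)) //.
apply: ler_sum => i _; rewrite normrZ -[leRHS]mul1r ler_wpM2r //.
exact: in_sphere_le1.
Qed.

Lemma rshift_idx0 (i : 'I_q) : rshift p.+1 i != @idx0 p q.
Proof. by rewrite eq_rlshift. Qed.

(** Distinct basis vectors anticommute, so only the squares survive, and their weights sum to 1 on
    the sphere. *)
Lemma vecq_mul_sq w : in_sphere w -> mul (vecq v w) (vecq v w) = - one.
Proof.
move=> ws; rewrite !vecqE (lin_sum (mul_linl _)).
under eq_bigr => i _ do rewrite (lin_sum (mul_linr _)).
rewrite sum_antisymmetric => [|i j ij].
  under eq_bigr => i _ do rewrite (linZ (mul_linl _)) (linZ (mul_linr _))
    mul_v_sq ?rshift_idx0 // scalerA -expr2.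
  by rewrite -scaler_suml ws scale1r.
rewrite !(linZ (mul_linl _)) !(linZ (mul_linr _)) !scalerA mulrC -scalerN.
by case: HM => _ _ -> //; rewrite ?rshift_idx0 // (inj_eq (@rshift_inj _ _)).
Qed.

Lemma vecq_mulK w b : in_sphere w -> mul (vecq v w) (mul (vecq v w) b) = - b.
Proof.
by move=> ws; rewrite left_alternative vecq_mul_sq // (linN (mul_linl _)) mul1l.
Qed.

Lemma lshift_idx0 (s : 'I_p.+1) : (lshift q s != @idx0 p q) = (s != ord0).
Proof. by rewrite (inj_eq (@lshift_inj _ _)). Qed.

(** The conjugate of [v_s]. It appears when [v_s] moves past [omega]: [v_0 = 1] commutes with it and
    the others anticommute, so [v_s (omega b) = omega (vbar_s b)]. *)
Definition vbar (s : 'I_p.+1) : A := if s == ord0 then one else - v (lshift q s).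

Lemma v_idx0 : v (lshift q ord0) = one.
Proof. by case: HM. Qed.

Lemma v_vecq_swap w s b :
  mul (v (lshift q s)) (mul (vecq v w) b) = mul (vecq v w) (mul (vbar s) b).
Proof.
rewrite /vbar; case: eqVneq => [->|s0]; first by rewrite v_idx0 !mul1l.
rewrite (linN (mul_linl _)) (linN (mul_linr _)); apply: mul_anticomm.
rewrite vecqE (lin_sum (mul_linl _)) (lin_sum (mul_linr _)) -sumrN.
apply: eq_bigr => i _; rewrite (linZ (mul_linl _)) (linZ (mul_linr _)) -scalerN.
by case: HM => _ _ -> //; rewrite ?lshift_idx0 ?rshift_idx0 ?eq_lrshift.
Qed.

Lemma vbar_v s b : mul (vbar s) (mul (v (lshift q s)) b) = b.
Proof.
rewrite /vbar; case: eqVneq => [->|s0]; first by rewrite v_idx0 !mul1l.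
rewrite (linN (mul_linl _)) left_alternative mul_v_sq ?lshift_idx0 //.
by rewrite (linN (mul_linl _)) mul1l opprK.
Qed.

Lemma vbar_v_anticomm s t b : s != t ->
  mul (vbar s) (mul (v (lshift q t)) b) = - mul (vbar t) (mul (v (lshift q s)) b).
Proof.
move=> st; rewrite /vbar.
have [s0|s0] := eqVneq s ord0; have [t0|t0] := eqVneq t ord0.
- by move: st; rewrite s0 t0 eqxx.
- by rewrite s0 v_idx0 !mul1l (linN (mul_linl _)) opprK.
- by rewrite t0 v_idx0 !mul1l (linN (mul_linl _)).
rewrite !(linN (mul_linl _)); congr (- _); apply: mul_anticomm.
by case: HM => _ _ -> //; rewrite ?lshift_idx0 // (inj_eq (@lshift_inj _ _)).
Qed.

Section SliceDerivative.
Implicit Types f g : 'rV[R]_p.+1 -> A.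
Context (w : 'rV[R]_q) (ws : in_sphere w).
Context (U : set 'rV[R]_p.+1) (oU : open U).
Local Notation W := (vecq v w).

Definition slice_D (f : 'rV[R]_p.+1 -> A) : 'rV[R]_p.+1 -> A :=
  fun y => mul W (Dxp mul v f y).

Lemma mul2_linear a b : linear (fun x => mul a (mul b x)).
Proof. by move=> k x y; rewrite !(mul_linr _). Qed.

Lemma slice_DE f : slice_D f = (fun y => \sum_(s < p.+1)
  ((fun x => mul W (mul (v (lshift q s)) x)) \o dpart s f) y).
Proof. by apply/funext => y; rewrite /slice_D /Dxp (lin_sum (mul_linr _)). Qed.

Lemma smooth_slice_D_term f s : smooth U f ->
  smooth U ((fun x => mul W (mul (v (lshift q s)) x)) \o dpart s f).
Proof.
move=> sf; apply: (smooth_linear oU (@mul2_linear W _) (linear_rV_continuous (@mul2_linear W _))).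
exact: smooth_dpart.
Qed.

Lemma smooth_slice_D f : smooth U f -> smooth U (slice_D f).
Proof.
move=> sf; rewrite slice_DE.
apply: (@smooth_sum R _ _ U 'I_p.+1 (index_enum _)
  (fun s => (fun x => mul W (mul (v (lshift q s)) x)) \o dpart s f) oU) => s.
exact: smooth_slice_D_term.
Qed.

Lemma symm_slice_D f : smooth U f -> symm U f -> symm U (slice_D f).
Proof.
move=> sf yf; rewrite slice_DE.
apply: (symm_sum _ oU) => s; first exact: smooth_slice_D_term.
apply: (symm_linear oU (@mul2_linear W _) (linear_rV_continuous (@mul2_linear W _))).
  exact: smooth_dpart.
exact: symm_dpart.
Qed.

Lemma pdl_slice_D f I y : smooth U f -> U y ->
  pdl I (slice_D f) y = \sum_(s < p.+1) mul W (mul (v (lshift q s)) (pdl (rcons I s) f y)).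
Proof.
move=> sf Uy; rewrite slice_DE.
rewrite (pdl_sum _ I oU (fun s => @smooth_slice_D_term f s sf) Uy).
apply: eq_bigr => s _; rewrite pdl_rcons.
exact: (pdl_linear I oU (@mul2_linear W _) (linear_rV_continuous (@mul2_linear W _))
  (smooth_dpart (i := s) sf) Uy).
Qed.

(** Moving both [omega] to the left turns the outer [D] into its conjugate and leaves
    [omega (omega S)] with [S] the sum of [vbar_s (v_t (d_s d_t f))] over [s, t]. Off the diagonal
    the coefficients are antisymmetric while the mixed derivatives are symmetric, so [S] is the
    Laplacian. *)
Lemma slice_D_sq f y : smooth U f -> symm U f -> U y ->
  slice_D (slice_D f) y = - lapxp f y.
Proof.
move=> sf yf Uy; rewrite {1}/slice_D /Dxp.
pose X s t := mul (vbar s) (mul (v (lshift q t)) (pdl [:: s; t] f y)).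
have E s : mul (v (lshift q s)) (pd (slice_D f) s y) = mul W (\sum_t X s t).
  rewrite -[pd _ s y]/(pdl [:: s] (slice_D f) y) pdl_slice_D //.
  rewrite !(lin_sum (mul_linr _)); apply: eq_bigr => t _.
  exact: v_vecq_swap.
under eq_bigr => s _ do rewrite E.
rewrite -(lin_sum (mul_linr _)) vecq_mulK // sum_antisymmetric.
  by congr (- _); apply: eq_bigr => s _; exact: vbar_v.
by move=> s t st; rewrite /X (yf [::] s t y Uy); exact: vbar_v_anticomm.
Qed.

Lemma smooth_mlap f : smooth U f -> smooth U (fun y => - lapxp f y).
Proof.
have lN : linear (fun x : A => - x) by move=> k x y; rewrite opprD scalerN.
move=> sf; rewrite (_ : (fun y => _) =
  (fun y => \sum_(s < p.+1) ((fun x : A => - x) \o pdl [:: s; s] f) y)).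
  apply: (@smooth_sum R _ _ U 'I_p.+1 (index_enum _)
    (fun s => (fun x : A => - x) \o pdl [:: s; s] f) oU) => s.
  exact: (smooth_linear oU lN (linear_rV_continuous lN) (smooth_pdl sf)).
by apply/funext => y; rewrite /lapxp -sumrN.
Qed.

Lemma eq_lapxp f g : (forall y, U y -> f y = g y) ->
  forall y, U y -> lapxp f y = lapxp g y.
Proof.
by move=> fg y Uy; apply: eq_bigr => s _; exact: (eq_pdl [:: s; s] oU fg Uy).
Qed.

Lemma smooth_mlap_pow k f : smooth U f -> smooth U (mlap_pow k f).
Proof. by move=> sf; elim: k => [|k IH]; [exact: sf|exact: smooth_mlap]. Qed.

Lemma mlap_pow_linear (l : A -> A) k f : linear l -> smooth U f ->
  forall y, U y -> mlap_pow k (l \o f) y = l (mlap_pow k f y).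
Proof.
move=> ll sf; elim: k => // k IH y Uy.
rewrite -[LHS]/(- lapxp (mlap_pow k (l \o f)) y) (eq_lapxp IH Uy).
rewrite -[mlap_pow k.+1 f y]/(- lapxp (mlap_pow k f) y) (linN ll) (lin_sum ll).
congr (- _); apply: eq_bigr => s _.
exact: (pdl_linear [:: s; s] oU ll (linear_rV_continuous ll)
  (smooth_mlap_pow (k := k) sf) Uy).
Qed.

Lemma smooth_iter_slice_D k f : smooth U f -> smooth U (iter k slice_D f).
Proof. by move=> sf; elim: k => [|k IH]; [exact: sf|exact: smooth_slice_D]. Qed.

Lemma symm_iter_slice_D k f : smooth U f -> symm U f -> symm U (iter k slice_D f).
Proof.
move=> sf yf; elim: k => [|k IH]; first exact: yf.
by apply: symm_slice_D IH; exact: smooth_iter_slice_D.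
Qed.

Lemma iter_slice_D_even k f y : smooth U f -> symm U f -> U y ->
  iter (2 * k) slice_D f y = mlap_pow k f y.
Proof.
move=> sf yf; elim: k y => // k IH y Uy.
have sg := @smooth_iter_slice_D (2 * k)%N f sf; have yg := @symm_iter_slice_D (2 * k)%N f sf yf.
rewrite mulnS !iterS (slice_D_sq sg yg Uy) (eq_lapxp IH Uy).
reflexivity.
Qed.

Lemma smooth_Dxp f : smooth U f -> smooth U (Dxp mul v f).
Proof.
move=> sf; apply: (@smooth_sum R _ _ U 'I_p.+1 (index_enum _)
  (fun s => mul (v (lshift q s)) \o dpart s f) oU) => s.
apply: (smooth_linear oU (@mul_linr _) (linear_rV_continuous (@mul_linr _))).
exact: smooth_dpart.
Qed.

Lemma iter_slice_D_odd k f y : smooth U f -> symm U f -> U y ->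
  iter (2 * k).+1 slice_D f y = mul W (mlap_pow k (Dxp mul v f) y).
Proof.
move=> sf yf Uy.
rewrite iterSr (iter_slice_D_even k (smooth_slice_D sf) (symm_slice_D sf yf) Uy).
exact: (mlap_pow_linear k (@mul_linr W) (smooth_Dxp sf) Uy).
Qed.

End SliceDerivative.

(** One application trades a derivative for a step of the offset: the bound at [rcons I s] with
    offset [k] has the factorial and power of [I] with offset [k.+1]. The constant [c] collects the
    norms of the product and of the basis vectors; coordinates of [w] are at most 1 on the sphere,
    so it does not depend on the direction. *)
Lemma slice_D_bound : exists2 c : R, 0 <= c & forall w U f K B k,
  in_sphere w -> open U -> smooth U f -> 0 <= K -> 0 <= B ->
  factorial_bound U f K B k -> factorial_bound U (slice_D w f) K (B * c) k.+1.
Proof.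
have [C C0 HC] := mul_norm_bound.
set V := \sum_(i < q) `|v (rshift p.+1 i)|.
have V0 : 0 <= V by exact: sumr_ge0.
exists (\sum_(s < p.+1) C * V * (C * `|v (lshift q s)|)).
  by apply: sumr_ge0 => s _; rewrite !mulr_ge0.
move=> w U f K B k ws oU sf K0 B0 bf I y Uy.
rewrite (pdl_slice_D w oU I sf Uy) (le_trans (ler_norm_sum _ _ _)) //.
set F := ((size I + k.+1)`!)%:R; set P := K ^+ _.
rewrite (_ : _ * F * P = \sum_(s < p.+1) C * V * (C * `|v (lshift q s)| * (B * F * P))); last first.
  by rewrite mulr_sumr !mulr_suml; apply: eq_bigr => s _; ring.
apply: ler_sum => s _.
apply: le_trans (HC _ _) _; apply: ler_pM; rewrite ?mulr_ge0 //.
  by rewrite ler_wpM2l // vecq_norm_le.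
apply: le_trans (HC _ _) _; apply: ler_wpM2l; first by rewrite mulr_ge0.
by have := bf (rcons I s) y Uy; rewrite size_rcons /F /P addSnnS.
Qed.

End AlternativeAlgebra.

(** * The Cauchy-Kovalevskaya extension *)

Section EuclideanNorm.
Context {R : realType} {q : nat}.
Implicit Types (u w : 'rV[R]_q).

Lemma euclZ (t : R) u : eucl (t *: u) = `|t| * eucl u.
Proof.
rewrite /eucl -sqrtr_sqr -sqrtrM ?sqr_ge0 // mulr_sumr.
by congr Num.sqrt; apply: eq_bigr => i _; rewrite mxE exprMn.
Qed.

Lemma eucl_sphere w : in_sphere w -> eucl w = 1.
Proof. by rewrite /eucl => ->; rewrite sqrtr1. Qed.

Lemma eucl0 : eucl (0 : 'rV[R]_q) = 0.
Proof. by rewrite -[0 in LHS](scale0r 0) euclZ normr0 mul0r. Qed.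

Lemma eucl_ge0 u : 0 <= eucl u.
Proof. exact: sqrtr_ge0. Qed.

Lemma eucl_continuous : continuous (@eucl R q).
Proof.
move=> u.
have E : (fun x : 'rV[R]_q => \sum_(i < q) x 0 i ^+ 2) @ u --> \sum_(i < q) u 0 i ^+ 2.
  apply: (@cvg_sum_seq R R _ 'I_q (nbhs u) (nbhs_filter u)) => i.
  exact: (continuous_cvg _ (@exprn_continuous R 2 _) (@coord_continuous R _ _ 0 i u)).
exact: (continuous_cvg _ (@sqrt_continuous R _) E).
Qed.

Lemma in_sphere_delta (i : 'I_q) : in_sphere (delta_mx 0 i : 'rV[R]_q).
Proof.
rewrite /in_sphere (bigD1 i) //= big1 ?addr0 ?mxE ?eqxx ?expr1n // => j ji.
by rewrite mxE (negbTE ji) expr0n.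
Qed.

End EuclideanNorm.

Section CKExtension.
Context {R : realType} {d : nat}.
Local Notation A := 'rV[R]_d.
Context (mul : A -> A -> A) (one : A) (conj : A -> A).
Context (Halg : alt_algebra_with_anti_involution mul one conj).
Context (p q : nat) (v : 'I_(p.+1 + q) -> A) (HM : M_hyp mul one conj v).
Context (Om0 : set 'rV[R]_p.+1) (f0 : 'rV[R]_p.+1 -> A).
Context (oOm0 : open Om0) (sf0 : smooth Om0 f0) (yf0 : symm Om0 f0).
Context (c : R) (c0 : 0 <= c).
Context (Hc : forall w U f K B k,
  in_sphere w -> open U -> smooth U f -> 0 <= K -> 0 <= B ->
  factorial_bound U f K B k -> factorial_bound U (slice_D mul v w f) K (B * c) k.+1).

(** [rho] and [K] are kept apart so that the ball can shrink around a nearby centre under an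
    unchanged estimate. The factor 4 is that of [divided_power_bound]. *)
Definition CK_radius_at (y : 'rV[R]_p.+1) (r rho K : R) : Prop :=
  [/\ 0 < rho, 0 < K, ball y rho `<=` Om0, factorial_bound (ball y rho) f0 K K 0 &
    4 * (c * K) * r < 1].

Definition CK_domain : set 'rV[R]_(p.+1 + q) :=
  [set x | exists rho K, CK_radius_at (lsubmx x) (eucl (rsubmx x)) rho K].

(** * The extension on the slice through one direction *)

Section FixedDirection.
Context (w : 'rV[R]_q) (ws : in_sphere w).
Implicit Types (y : 'rV[R]_p.+1) (z : 'rV[R]_(p.+1 + 1)).
Local Notation W := (vecq v w).

Definition CK_coef (k : nat) : 'rV[R]_p.+1 -> A := iter k (slice_D mul v w) f0.

Lemma smooth_CK_coef U k : open U -> U `<=` Om0 -> smooth U (CK_coef k).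
Proof.
move=> oU UO; apply: (smooth_sub UO).
exact: (smooth_iter_slice_D Halg oOm0 sf0).
Qed.

Lemma CK_coef_bound y rho K k : 0 < rho -> 0 < K -> ball y rho `<=` Om0 ->
  factorial_bound (ball y rho) f0 K K 0 ->
  factorial_bound (ball y rho) (CK_coef k) K (K * c ^+ k) k.
Proof.
move=> r0 K0 bO bf; have oB : open (ball y rho) by exact: ball_open.
elim: k => [|k IH]; first by rewrite expr0 mulr1.
rewrite exprSr mulrA; apply: (Hc ws oB (smooth_CK_coef oB bO) (ltW K0) _ IH).
by rewrite mulr_ge0 ?exprn_ge0 // ltW.
Qed.

Lemma CK_coef_even k y : Om0 y -> CK_coef (2 * k) y = mlap_pow k f0 y.
Proof. exact: (iter_slice_D_even Halg HM ws oOm0 k sf0 yf0). Qed.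

Lemma CK_coef_odd k y : Om0 y ->
  CK_coef (2 * k).+1 y = mul W (mlap_pow k (Dxp mul v f0) y).
Proof. exact: (iter_slice_D_odd Halg HM ws oOm0 k sf0 yf0). Qed.

Definition CK_slice (z : 'rV[R]_(p.+1 + 1)) : A :=
  limn (series (fun k => power_term CK_coef k z)).

(** Because [4 c K r < 1] is strict, the same ball around [lsubmx z] and the same [K] serve for all
    points near [z]; the bounds are uniform there and [series_smooth] applies. *)
Lemma CK_slice_local z rho K : CK_radius_at (lsubmx z) `|r_coord z| rho K ->
  exists2 delta, 0 < delta &
  [/\ (forall I, exists C, forall N z', ball z delta z' ->
        \sum_(0 <= k < N) `|pdl I (power_term CK_coef k) z'| <= C),
      smooth (ball z delta) CK_slice,
      (forall I z', ball z delta z' ->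
         series (fun k => pdl I (power_term CK_coef k) z') @ \oo --> pdl I CK_slice z') &
      (forall I, {for z, continuous (pdl I CK_slice)})].
Proof.
move=> [r0 K0 bO bf zK]; set U := ball (lsubmx z) rho.
have oU : open U by exact: ball_open.
have cK0 : 0 <= 4 * (c * K) by rewrite !mulr_ge0 // ltW.
have nz : nbhs z [set z' | U (lsubmx z') /\ 4 * (c * K) * `|r_coord z'| < 1].
  apply: (@filterI _ (nbhs z) (nbhs_filter z)).
    by apply: open_nbhs_nbhs; split; [exact: open_lsubmx|exact: ballxx].
  have cr : (fun t : R => 4 * (c * K) * `|t|) @ r_coord z --> 4 * (c * K) * `|r_coord z|.
    by apply: cvgM; [exact: cvg_cst|apply: cvg_norm; exact: cvg_id].
  have nr : \forall t \near r_coord z, 4 * (c * K) * `|t| < 1 by exact: (cvgr_lt _ cr).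
  exact: (linear_rV_continuous (@r_coord_linear R p) nr).
have [delta /= d0 dQ] := (nbhs_ballP z _).1 nz.
have QU z' : ball z delta z' -> U (lsubmx z') by move=> /dQ [].
have sh k : smooth U (CK_coef k) by exact: smooth_CK_coef.
have sT k : smooth (ball z delta) (power_term CK_coef k).
  exact: (smooth_sub QU (smooth_power_term oU (sh k))).
have bT I : exists C, forall N z', ball z delta z' ->
    \sum_(0 <= k < N) `|pdl I (power_term CK_coef k) z'| <= C.
  have [C HC] := @power_terms_summable R p d CK_coef U K K c I oU (ltW K0) (ltW K0) c0 sh
    (fun k => CK_coef_bound k r0 K0 bO bf).
  exists C => N z' bz; apply: HC; first exact: QU.
  by have [_ /ltW] := dQ _ bz.
exists delta => //.
have [_ sS cS kS] := series_smooth sT bT.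
by split=> //; exact: kS.
Qed.

Lemma power_term_even k z : Om0 (lsubmx z) ->
  power_term CK_coef (2 * k) z = CK_term1 f0 (lsubmx z) (r_coord z) k.
Proof.
by move=> Oz; rewrite /power_term /divided_power leq0n subn0 (CK_coef_even k Oz).
Qed.

Lemma power_term_odd k z : Om0 (lsubmx z) ->
  power_term CK_coef (2 * k).+1 z = mul W (CK_term2 mul v f0 (lsubmx z) (r_coord z) k).
Proof.
move=> Oz; rewrite /power_term /divided_power leq0n subn0 (CK_coef_odd k Oz).
by rewrite -(linZ (mul_linr Halg _)).
Qed.

Lemma sum_even_odd (V : zmodType) (a : nat -> V) N :
  \sum_(0 <= k < 2 * N) a k = \sum_(0 <= k < N) (a (2 * k)%N + a (2 * k).+1).
Proof.
elim: N => [|N IH]; first by rewrite !big_geq.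
by rewrite mulnS !addSn add0n !big_nat_recr //= IH addrA.
Qed.

(** The even terms form the first series and the odd terms are [omega] times the second. Both are
    dominated by the absolutely convergent full series, so they converge separately, and its partial
    sums of even length give the formula. *)
Lemma CK_slice_split z rho K : CK_radius_at (lsubmx z) `|r_coord z| rho K ->
  [/\ cvgn (series (CK_term1 f0 (lsubmx z) (r_coord z))),
      cvgn (series (CK_term2 mul v f0 (lsubmx z) (r_coord z))) &
      CK_slice z = limn (series (CK_term1 f0 (lsubmx z) (r_coord z))) +
        mul W (limn (series (CK_term2 mul v f0 (lsubmx z) (r_coord z))))].
Proof.
move=> HK; have [delta d0 [bT _ cT _]] := CK_slice_local HK.
have zz : ball z delta z by exact: ballxx.
have Oz : Om0 (lsubmx z) by case: HK => r0 _ bO _ _; apply: bO; exact: ballxx.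
set T1 := CK_term1 _ _ _; set T2 := CK_term2 _ _ _ _ _.
pose T k := power_term CK_coef k z.
have [C /(_ _ z zz) HC] := bT [::].
have cv2 (a : nat -> A) (B : R) : 0 <= B ->
    (forall k, `|a k| <= B * (`|T (2 * k)%N| + `|T (2 * k).+1|)) -> cvgn (series a).
  move=> B0 aT; apply: (@series_absolute_cvg R d _ (B * C)) => N.
  apply: le_trans (ler_wpM2l B0 (HC (2 * N)%N)).
  by rewrite sum_even_odd mulr_sumr; apply: ler_sum => k _; exact: aT.
have [D D0 HD] := mul_norm_bound Halg.
have c1 : cvgn (series T1).
  apply: (cv2 _ 1) => // k.
  by rewrite mul1r /T power_term_even // lerDl.
have c2 : cvgn (series T2).
  apply: (cv2 _ (D * `|W|)) => [|k]; first by rewrite mulr_ge0.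
  (* Left multiplication by [- omega] inverts that by [omega], which recovers the second series from
     the odd terms. *)
  have -> : T2 k = - mul W (T (2 * k).+1).
    by rewrite /T power_term_odd // (vecq_mulK Halg HM) // opprK.
  rewrite normrN; apply: le_trans (HD _ _) _.
  by rewrite ler_wpM2l ?mulr_ge0 // lerDr.
split=> //.
have cTz : series T @ \oo --> CK_slice z := cT [::] z zz.
have lW := linear_rV_continuous (mul_linr Halg W).
have cE : (fun N => series T1 N + mul W (series T2 N)) @ \oo -->
    limn (series T1) + mul W (limn (series T2)).
  by apply: cvgD => //; exact: (continuous_cvg _ (lW _) c2).
have E : (fun N => series T1 N + mul W (series T2 N)) = (fun N => series T (2 * N)%N).
  apply/funext => N; rewrite /series /= sum_even_odd (lin_sum (mul_linr Halg W)).
  rewrite -big_split; apply: eq_bigr => k _.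
  by rewrite /T power_term_even // power_term_odd.
have c2N : (fun N => series T (2 * N)%N) @ \oo --> CK_slice z.
  apply: (cvg_comp _ _ _ cTz); apply/cvgnyPge => M; near=> N.
  by apply: leq_trans (leq_pmull N (isT : 0 < 2)%N); near: N; exact: nbhs_infty_ge.
by rewrite E in cE; exact: (cvg_unique _ c2N cE).
Unshelve. all: by end_near. Qed.

Lemma CK_term1_norm y s k : CK_term1 f0 y `|s| k = CK_term1 f0 y s k.
Proof. by rewrite /CK_term1 !exprM real_normK ?num_real. Qed.

Lemma CK_term2N y s k : CK_term2 mul v f0 y (- s) k = - CK_term2 mul v f0 y s k.
Proof.
rewrite /CK_term2 -scaleNr; congr (_ *: _).
by rewrite exprNn -signr_odd /= mul2n odd_double mulN1r mulNr.
Qed.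

Lemma lsubmx_slice_pt z : lsubmx (slice_pt w z) = lsubmx z.
Proof. exact: row_mxKl. Qed.

Lemma eucl_slice_pt z : eucl (rsubmx (slice_pt w z)) = `|r_coord z|.
Proof. by rewrite row_mxKr euclZ eucl_sphere // mulr1. Qed.

(* On a slice [r] ranges over all of [R], while [CK] uses [|r|] and [omega] up to sign: the
   even terms do not see the sign and the odd ones absorb it. *)
Lemma CK_slice_pt z : CK_domain (slice_pt w z) -> CK mul v f0 (slice_pt w z) = CK_slice z.
Proof.
rewrite /CK_domain /= lsubmx_slice_pt eucl_slice_pt => -[rho [K HK]].
have [c1 c2 ->] := CK_slice_split HK.
rewrite /CK lsubmx_slice_pt eucl_slice_pt row_mxKr -/(r_coord z).
set y := lsubmx z; set s := r_coord z.
have -> : CK_term1 f0 y `|s| = CK_term1 f0 y s by apply/funext => k; exact: CK_term1_norm.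
congr (_ + _); rewrite scalerA.
have lv := vecq_linear v.
have [s0|s0|s0] := ltgtP s 0.
- rewrite ltr0_norm // invrN mulNr mulVf ?lt_eqF // scaleN1r (linN lv).
  have -> : CK_term2 mul v f0 y (- s) = - CK_term2 mul v f0 y s.
    by apply/funext => k; exact: CK_term2N.
  rewrite (linN (mul_linl Halg _)) -(linN (mul_linr Halg _)); congr mul.
  have -> : series (- CK_term2 mul v f0 y s) = - series (CK_term2 mul v f0 y s).
    by apply/funext => N; exact: sumrN.
  by rewrite limN // opprK.
- by rewrite gtr0_norm // mulVf ?gt_eqF // scale1r.
(* At [r = 0] the direction is undefined, but every odd term vanishes. *)
rewrite s0 normr0; have -> : series (CK_term2 mul v f0 y 0) = cst 0.
  apply/funext => N; rewrite /series /= big1 // => k _.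
  by rewrite /CK_term2 expr0n mul0r scale0r.
by rewrite lim_cst // !(lin0 (mul_linr Halg _)).
Qed.

(* The partial sums telescope to the last term, as [omega * (omega * D h) = - D h]. *)
Lemma slice_monogenic_term (z : 'rV[R]_(p.+1 + 1)) N : Om0 (lsubmx z) ->
  \sum_(s < p.+1) mul (v (lshift q s))
      (series (fun k => pdl [:: xp_idx s] (power_term CK_coef k) z) N.+1) +
    mul W (series (fun k => pdl [:: r_idx p] (power_term CK_coef k) z) N.+1) =
  \sum_(s < p.+1) mul (v (lshift q s)) (pdl [:: xp_idx s] (power_term CK_coef N) z).
Proof.
move=> Oz; set r := r_coord z.
have sh k : smooth Om0 (CK_coef k) by exact: smooth_CK_coef.
have Ex s k : pdl [:: xp_idx s] (power_term CK_coef k) z =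
    divided_power k 0 r *: dpart s (CK_coef k) (lsubmx z).
  exact: (@derive_val _ _ _ _ _ _ _ (is_derive_product_l (divided_power k 0) (sh k [::] s _ Oz))).
have Er k : pdl [:: r_idx p] (power_term CK_coef k) z =
    divided_power k 1 r *: CK_coef k (lsubmx z).
  exact: (@derive_val _ _ _ _ _ _ _ (is_derive_product_r (CK_coef k) ord0
    (is_derive_divided_power k 0 r))).
pose a k := \sum_(s < p.+1) mul (v (lshift q s)) (pdl [:: xp_idx s] (power_term CK_coef k) z).
have aE k : a k = divided_power k 0 r *: Dxp mul v (CK_coef k) (lsubmx z).
  rewrite /a /Dxp scaler_sumr; apply: eq_bigr => s _.
  by rewrite Ex (linZ (mul_linr Halg _)).
(* The [r]-derivative lowers [r^(k+1) / (k+1)!] to [r^k / k!], so the radial part of term [k.+1]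
   meets the [D] part of term [k]. *)
have bE k : mul W (pdl [:: r_idx p] (power_term CK_coef k.+1) z) = - a k.
  rewrite Er (linZ (mul_linr Halg _)) aE -scalerN; congr (_ *: _).
  exact: (vecq_mulK Halg HM).
have b0 : mul W (pdl [:: r_idx p] (power_term CK_coef 0) z) = 0.
  by rewrite Er scale0r (lin0 (mul_linr Halg _)).
rewrite -/(a N) (_ : \sum_(s < p.+1) _ = \sum_(0 <= k < N.+1) a k); last first.
  rewrite /a exchange_big /=; apply: eq_bigr => s _.
  by rewrite /series /= (lin_sum (mul_linr Halg _)).
rewrite /series /= (lin_sum (mul_linr Halg _)) big_nat_recr //=.
rewrite [X in _ + X]big_nat_recl // b0 add0r.
have S : \sum_(0 <= k < N) mul W (pdl [:: r_idx p] (power_term CK_coef k.+1) z) =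
    - \sum_(0 <= k < N) a k.
  by rewrite -sumrN; apply: eq_bigr => k _; exact: bE.
by rewrite [X in _ + X]S addrAC subrr add0r.
Qed.

(** The remainder left by telescoping is built linearly from general terms of convergent series,
    hence tends to 0. *)
Lemma CK_slice_monogenic z rho K : CK_radius_at (lsubmx z) `|r_coord z| rho K ->
  \sum_(s < p.+1) mul (v (lshift q s)) (pdl [:: xp_idx s] CK_slice z) +
    mul W (pdl [:: r_idx p] CK_slice z) = 0.
Proof.
move=> HK; have [delta d0 [_ _ cT _]] := CK_slice_local HK.
have zz : ball z delta z by exact: ballxx.
have Oz : Om0 (lsubmx z) by case: HK => r0 _ bO _ _; apply: bO; exact: ballxx.
have lm b := linear_rV_continuous (mul_linr Halg b).
have cE : (fun N => \sum_(s < p.+1) mul (v (lshift q s))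
      (series (fun k => pdl [:: xp_idx s] (power_term CK_coef k) z) N) +
    mul W (series (fun k => pdl [:: r_idx p] (power_term CK_coef k) z) N)) @ \oo -->
   \sum_(s < p.+1) mul (v (lshift q s)) (pdl [:: xp_idx s] CK_slice z) +
    mul W (pdl [:: r_idx p] CK_slice z).
  apply: cvgD; last exact: (continuous_cvg _ (lm _ _) (cT [:: r_idx p] z zz)).
  by apply: cvg_sum_seq => s; exact: (continuous_cvg _ (lm _ _) (cT [:: xp_idx s] z zz)).
have c0' : (fun N => \sum_(s < p.+1) mul (v (lshift q s))
    (pdl [:: xp_idx s] (power_term CK_coef N) z)) @ \oo --> (\sum_(s < p.+1) (0 : A)).
  apply: cvg_sum_seq => s; rewrite -(lin0 (mul_linr Halg (v (lshift q s)))).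
  apply: (continuous_cvg _ (lm _ _)); apply: cvg_series_cvg_0.
  by apply/cvg_ex; eexists; exact: (cT [:: xp_idx s] z zz).
have Z : \sum_(s < p.+1) (0 : A) = 0 by rewrite big1.
rewrite Z in c0'.
move: cE; set u := (fun N => _ + _) => cE.
(* The telescoping identity concerns [N.+1] terms, so the sequence is shifted before the limits are
   compared. *)
have cE' : [sequence u n.+1]_n @ \oo --> \sum_(s < p.+1) mul (v (lshift q s))
    (pdl [:: xp_idx s] CK_slice z) + mul W (pdl [:: r_idx p] CK_slice z).
  by rewrite cvg_shiftS.
have Eu : [sequence u n.+1]_n = (fun N => \sum_(s < p.+1) mul (v (lshift q s))
    (pdl [:: xp_idx s] (power_term CK_coef N) z)).
  by apply/funext => N; exact: slice_monogenic_term.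
by rewrite Eu in cE'; exact: (cvg_unique _ cE' c0').
Qed.

End FixedDirection.

(** * The domain and the assembled properties of the extension *)

Lemma open_CK_domain : open CK_domain.
Proof.
rewrite openE => x [rho [K [r0 K0 bO bf xK]]].
have ll : linear (fun x : 'rV[R]_(p.+1 + q) => lsubmx x) by move=> k a b; rewrite linearP.
have lr : linear (fun x : 'rV[R]_(p.+1 + q) => rsubmx x) by move=> k a b; rewrite linearP.
have n1 : nbhs x [set x' | ball (lsubmx x) (rho / 2) (lsubmx x')].
  by apply: (linear_rV_continuous ll); apply: nbhsx_ballx; rewrite divr_gt0.
have n2 : nbhs x [set x' | 4 * (c * K) * eucl (rsubmx x') < 1].
  have cr : (fun t : R => 4 * (c * K) * t) @ eucl (rsubmx x) -->
      4 * (c * K) * eucl (rsubmx x).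
    by apply: cvgM; [exact: cvg_cst|exact: cvg_id].
  have nr : \forall t \near eucl (rsubmx x), 4 * (c * K) * t < 1 by exact: (cvgr_lt _ cr).
  exact: (linear_rV_continuous lr (@eucl_continuous R q _ _ nr)).
have := @filterI _ (nbhs x) (nbhs_filter x) _ _ n1 n2.
apply: (@filterS _ (nbhs x) (nbhs_filter x)) => x' [b' K'].
(* Halving the radius keeps the ball around the new centre inside the old one, so [K] is
   unchanged. *)
have sub : ball (lsubmx x') (rho / 2) `<=` ball (lsubmx x) rho.
  by move=> y yb; rewrite [rho]splitr; exact: ball_triangle b' yb.
exists (rho / 2), K; split=> //; first by rewrite divr_gt0.
  by move=> y /sub; exact: bO.
by move=> I y /sub; exact: bf.
Qed.

Lemma CK_domain_scale y (u : 'rV[R]_q) t : `|t| <= 1 ->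
  CK_domain (row_mx y u) -> CK_domain (row_mx y (t *: u)).
Proof.
move=> t1; rewrite /CK_domain /= !row_mxKl !row_mxKr => -[rho [K [r0 K0 bO bf yK]]].
exists rho, K; split=> //; apply: le_lt_trans yK.
apply: ler_wpM2l; first by rewrite !mulr_ge0 // ltW.
by rewrite euclZ ler_piMl // eucl_ge0.
Qed.

Lemma CK_domain_p_symmetric : p_symmetric CK_domain.
Proof.
move=> y r w eta r0 ws es; rewrite /CK_domain /= !row_mxKl !row_mxKr.
by rewrite !euclZ !eucl_sphere.
Qed.

Lemma CK_domain_sub x : CK_domain x -> Om0 (lsubmx x).
Proof. by move=> [rho [K [r0 _ bO _ _]]]; apply: bO; exact: ballxx. Qed.

Lemma slice_pt_linear w : linear (@slice_pt R p q w).
Proof.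
move=> k x y; rewrite /slice_pt !linearP /= !mxE scalerDl -scalerA.
by rewrite -add_row_mx -scale_row_mx.
Qed.

Lemma open_slice_set w : open (slice_set CK_domain w).
Proof.
have := linear_rV_continuous (@slice_pt_linear w) => /continuousP; apply.
exact: open_CK_domain.
Qed.

Lemma CK_gps_monogenic : gps_monogenic mul v (CK mul v f0) CK_domain.
Proof.
move=> w ws g; set Q := slice_set CK_domain w.
have oQ : open Q by exact: open_slice_set.
have E z : Q z -> g z = CK_slice w z by exact: CK_slice_pt.
have HQ z : Q z -> exists rho K, CK_radius_at (lsubmx z) `|r_coord z| rho K.
  by rewrite /Q /slice_set /CK_domain /= lsubmx_slice_pt eucl_slice_pt.
have dE i z : Q z -> dpart i g z = dpart i (CK_slice w) z by exact: eq_dpart.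
split.
  move=> i; split=> z Qz; have [rho [K HK]] := HQ z Qz;
    have [delta d0 [_ sS _ kS]] := CK_slice_local ws HK.
    apply: (eq_derivable oQ (fun z Qz => esym (E z Qz)) Qz).
    by apply: (sS [::]); exact: ballxx.
  suff : dpart i g @ z --> dpart i g z by [].
  rewrite (dE i z Qz); apply: cvg_trans (kS [:: i]).
  apply: (@near_eq_cvg _ _ (nbhs z) (nbhs_filter z)).
  exact: (open_eq_near oQ (fun z Qz => esym (dE i z Qz)) Qz).
move=> z Qz; have [rho [K HK]] := HQ z Qz.
rewrite -[RHS](CK_slice_monogenic ws HK); congr (_ + mul _ _); last exact: dE.
by apply: eq_bigr => s _; congr mul; exact: dE.
Qed.

(** The two series depend on [x_p] and [r] only, so they can be read on the slice through any one
    unit vector; [0 < q] provides the first basis vector. *)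
Lemma CK_converges : (0 < q)%N -> CK_series_converge mul v f0 CK_domain.
Proof.
move=> q0 x [rho [K HK]].
pose w : 'rV[R]_q := delta_mx 0 (Ordinal q0).
have ws : in_sphere w by exact: in_sphere_delta.
pose z : 'rV[R]_(p.+1 + 1) := row_mx (lsubmx x) (const_mx (eucl (rsubmx x))).
have zl : lsubmx z = lsubmx x by exact: row_mxKl.
have zr : r_coord z = eucl (rsubmx x) by rewrite /r_coord row_mxKr mxE.
have : CK_radius_at (lsubmx z) `|r_coord z| rho K.
  by rewrite zl zr ger0_norm // eucl_ge0.
by move=> /(CK_slice_split ws) []; rewrite zl zr.
Qed.

Lemma CK_restriction y : CK mul v f0 (row_mx y 0) = f0 y.
Proof.
rewrite /CK row_mxKl row_mxKr eucl0.
have -> : limn (series (CK_term1 f0 y 0)) = f0 y.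
  apply: cvg_lim => //; rewrite -cvg_shiftS.
  rewrite (_ : [sequence _]_n = cst (f0 y)); first exact: cvg_cst.
  apply/funext => N; rewrite /series /= big_nat_recl // big1 => [|k _].
    by rewrite addr0 /CK_term1 expr0 fact0 divr1 scale1r.
  by rewrite /CK_term1 mulnS addSn expr0n /= mul0r scale0r.
have -> : series (CK_term2 mul v f0 y 0) = cst 0.
  apply/funext => N; rewrite /series /= big1 // => k _.
  by rewrite /CK_term2 expr0n mul0r scale0r.
by rewrite lim_cst // (lin0 (mul_linr Halg _)) addr0.
Qed.

Lemma CK_domain_base : ranalytic_on Om0 f0 -> forall y, Om0 y -> CK_domain (row_mx y 0).
Proof.
move=> af y Oy; have [K [K0 KO _ _ bK]] := ranalytic_on_local oOm0 af Oy.
exists K^-1, K; rewrite /CK_radius_at row_mxKl row_mxKr eucl0 mulr0; split=> //.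
by rewrite invr_gt0.
Qed.

(* Each slice is a union of vertical segments attached to the connected set [Om0]. *)
Lemma CK_slice_domain : ranalytic_on Om0 f0 -> is_domain Om0 -> slice_domain CK_domain.
Proof.
move=> af [_ cO [y0 Oy0]]; split; first by exists y0; exact: CK_domain_base.
move=> w ws; set Q := slice_set CK_domain w.
have base y : Om0 y -> Q (row_mx y 0).
  move=> Oy; rewrite /Q /slice_set /slice_pt /= row_mxKl row_mxKr mxE scale0r.
  exact: CK_domain_base.
split; [exact: open_slice_set| |by exists (row_mx y0 0); exact: base].
pose B : set 'rV[R]_(p.+1 + 1) := (fun y => row_mx y 0) @` Om0.
pose vert (z : 'rV[R]_(p.+1 + 1)) (t : R) : 'rV[R]_(p.+1 + 1) :=
  row_mx (lsubmx z) (t *: rsubmx z).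
have cB : connected B.
  apply: connected_continuous_connected cO _; apply: continuous_subspaceT.
  apply: linear_rV_continuous => k a b.
  by rewrite -[in LHS](scaler0 _ k) -[X in row_mx _ X]addr0 -add_row_mx -scale_row_mx.
have cv z : connected (vert z @` `[0, 1]).
  apply: connected_continuous_connected; first exact: segment_connected.
  apply: continuous_subspaceT => t.
  rewrite (_ : vert z = fun t => row_mx (lsubmx z) 0 + t *: row_mx 0 (rsubmx z)).
    by apply: cvgD; [exact: cvg_cst|exact: scale_vec_continuous].
  by apply/funext => s; rewrite scale_row_mx add_row_mx scaler0 addr0 add0r.
have -> : Q = \bigcup_(z in Q) (B `|` vert z @` `[0, 1]).
  apply/seteqP; split=> [z Qz|x [z Qz [[y Oy <-]|[t t01 <-]]]].
  - exists z => //; right; exists 1; first by rewrite /= in_itv /= ler01 lexx.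
    by rewrite /vert scale1r hsubmxK.
  - exact: base.
  rewrite /Q /slice_set /slice_pt /= /vert row_mxKl row_mxKr mxE -scalerA.
  apply: CK_domain_scale Qz.
  by move: t01; rewrite /= in_itv /= => /andP[t0 t1]; rewrite ger0_norm.
apply: bigcup_connected.
  by exists (row_mx y0 0) => z _; left; exists y0.
move=> z Qz; apply: connectedU => //.
have Oz : Om0 (lsubmx z) by have := CK_domain_sub Qz; rewrite lsubmx_slice_pt.
exists (row_mx (lsubmx z) 0); split; first by exists (lsubmx z).
by exists 0; [rewrite /= in_itv /= ler01 lexx|rewrite /vert scale0r].
Qed.

End CKExtension.

Theorem theorem3p3 (R : realType) (d : nat)
  (mul : 'rV[R]_d -> 'rV[R]_d -> 'rV[R]_d) (one : 'rV[R]_d) (conj : 'rV[R]_d -> 'rV[R]_d)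
  (p q : nat) (v : 'I_(p.+1 + q) -> 'rV[R]_d)
  (Om0 : set 'rV[R]_p.+1) (f0 : 'rV[R]_p.+1 -> 'rV[R]_d) :
  alt_algebra_with_anti_involution mul one conj ->
  (0 < q)%N ->
  M_hyp mul one conj v ->
  is_domain Om0 ->
  ranalytic_on Om0 f0 ->
  exists Om : set 'rV[R]_(p.+1 + q),
    [/\ [/\ open Om, p_symmetric Om, slice_domain Om,
            (forall y, Om0 y -> Om (row_mx y 0)) &
            (forall x, Om x -> Om0 (lsubmx x))],
        CK_series_converge mul v f0 Om,
        gps_monogenic mul v (CK mul v f0) Om &
        (forall y, Om0 y -> CK mul v f0 (row_mx y 0) = f0 y)].
Proof.
move=> Halg q0 HM dOm0 af; have [oO _ _] := dOm0.
(* [c] depends only on the product and the basis, and is fixed first because the domain is defined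
   from it. *)
have [c c0 Hc] := slice_D_bound Halg v.
have sf : smooth Om0 f0.
  move=> I i z /(ranalytic_on_local oO af) [K [K0 _ sK _ _]].
  by apply: sK; apply: ballxx; rewrite invr_gt0.
have yf : symm Om0 f0.
  move=> I i j z /(ranalytic_on_local oO af) [K [K0 _ _ yK _]].
  by apply: yK; apply: ballxx; rewrite invr_gt0.
exists (@CK_domain R d p q Om0 f0 c); split.
- split.
  + exact: open_CK_domain.
  + exact: CK_domain_p_symmetric.
  + exact: (CK_slice_domain q oO c0 af dOm0).
  + exact: CK_domain_base.
  + exact: CK_domain_sub.
- exact: (CK_converges Halg HM oO sf yf c0 Hc).
- exact: (CK_gps_monogenic Halg HM oO sf yf c0 Hc).
- by move=> y _; exact: (CK_restriction Halg).
Qed.
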